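(* Let $\mathcal{X},\mathcal{Y}_1,\mathcal{Y}_2$ be finite sets and consider the binary hypothesis testing system described in the context, with null pmf $P_{XY_1Y_2}$ and alternative pmf $\bar P_{XY_1Y_2}$, where $\bar P_{XY_1Y_2}(x,y_1,y_2)>0$ for all $(x,y_1,y_2)$. Let $R_1\ge 0$, $R_2\ge 0$ and $\epsilon_1,\epsilon_2\in(0,1)$. Then the error-exponents region $\mathcal{E}(R_1,R_2,\epsilon_1,\epsilon_2)$ contains every nonnegative pair $(\theta_1,\theta_2)$ for which there exists $(U,V)\in\mathcal{S}(R_1,R_2)$ such that \[ \theta_1\le \min_{(\tilde U,\tilde X,\tilde Y_1)\in\mathcal{L}_1(U)} D\big(P_{\tilde U\tilde X\tilde Y_1}\,\|\,P_{\bar U\bar X\bar Y_1}\big), \] \[ \theta_2\le \min_{(\tilde U,\tilde V,\tilde X,\tilde Y_1,\tilde Y_2)\in\mathcal{L}_2(U,V)} D\big(P_{\tilde V\tilde U\tilde X\tilde Y_1\tilde Y_2}\,\|\,P_{\bar V\bar U\bar X\bar Y_1\bar Y_2}\big). \]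
   Context: Setting: Under hypothesis $\mathcal{H}=1$ (null) the triples $(X_t,Y_{1,t},Y_{2,t})$, $t=1,\dots,n$, are i.i.d. $\sim P_{XY_1Y_2}$ on $\mathcal{X}\times\mathcal{Y}_1\times\mathcal{Y}_2$; under $\mathcal{H}=2$ (alternative) they are i.i.d. $\sim \bar P_{XY_1Y_2}$. Write $(X,Y_1,Y_2)\sim P_{XY_1Y_2}$. A code of blocklength $n$ consists of: an encoder $\phi_{1,n}:\mathcal{X}^n\to\{1,\dots,\|\phi_{1,n}\|\}$ producing $M_1=\phi_{1,n}(X^n)$, sent to both detectors; at Detector 1 (which observes $Y_1^n$) a map $\phi_{2,n}:\{1,\dots,\|\phi_{1,n}\|\}\times\mathcal{Y}_1^n\to\{1,\dots,\|\phi_{2,n}\|\}$ producing $M_2=\phi_{2,n}(M_1,Y_1^n)$, sent to Detector 2, and a decision $\hat{\mathcal H}_1=\psi_{1,n}(M_1,Y_1^n)\in\{1,2\}$; at Detector 2 (which observes $Y_2^n$) a decision $\hat{\mathcal H}_2=\psi_{2,n}(M_1,M_2,Y_2^n)\in\{1,2\}$. Let $\alpha_{k,n}=\Pr[\hat{\mathcal H}_k\neq 1\mid\mathcal H=1]$ and $\beta_{k,n}=\Pr[\hat{\mathcal H}_k\neq 2\mid \mathcal H=2]$, $k=1,2$. A pair $(\theta_1,\theta_2)$ is achievable for $(R_1,R_2,\epsilon_1,\epsilon_2)$ if there exist codes for every $n$ with $\limsup_n\alpha_{k,n}\le\epsilon_k$, $\theta_k\le\liminf_n -\frac1n\log\beta_{k,n}$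 and $\limsup_n\frac1n\log\|\phi_{k,n}\|\le R_k$ for $k=1,2$. $\mathcal{E}(R_1,R_2,\epsilon_1,\epsilon_2)$ is the closure of the set of achievable pairs. Definitions: $\mathcal{S}(R_1,R_2)$ is the set of pairs of random variables $(U,V)$ on finite alphabets, jointly distributed with $(X,Y_1,Y_2)$ so that $U - X - (Y_1,Y_2)$ and $V-(Y_1,U)-(Y_2,X)$ are Markov chains, $I(U;X)\le R_1$ and $I(V;Y_1|U)\le R_2$ (all under $P_{XY_1Y_2}$). For such $(U,V)$: $\mathcal{L}_1(U)$ is the set of joint laws of $(\tilde U,\tilde X,\tilde Y_1)$ with $P_{\tilde U\tilde X}=P_{UX}$ and $P_{\tilde U\tilde Y_1}=P_{UY_1}$; $\mathcal{L}_2(U,V)$ is the set of joint laws of $(\tilde U,\tilde V,\tilde X,\tilde Y_1,\tilde Y_2)$ with $P_{\tilde U\tilde X}=P_{UX}$, $P_{\tilde U\tilde V\tilde Y_1}=P_{UVY_1}$, $P_{\tilde U\tilde V\tilde Y_2}=P_{UVY_2}$. Further $(\bar U,\bar V,\bar X,\bar Y_1,\bar Y_2)$ has joint pmf $\bar P_{XY_1Y_2}(x,y_1,y_2)P_{U|X}(u|x)P_{V|Y_1U}(v|y_1,u)$, i.e. $(\bar X,\bar Y_1,\bar Y_2)\sim\bar P_{XY_1Y_2}$, $P_{\bar U|\bar X}=P_{U|X}$, $P_{\bar V|\bar Y_1\bar U}=P_{V|Y_1U}$, with $\bar U-\bar X-(\bar Y_1,\bar Y_2)$ and $\bar V-(\bar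 Y_1,\bar U)-(\bar X,\bar Y_2)$ Markov chains. $D(\cdot\|\cdot)$ is Kullback–Leibler divergence. *)

(* Defs.v *)
From HB Require Import structures.
From mathcomp Require Import all_boot all_order all_algebra.
From mathcomp Require Import all_classical all_reals all_analysis.
Set Implicit Arguments.
Unset Strict Implicit.
Unset Printing Implicit Defensive.
Import Order.TTheory GRing.Theory Num.Theory.
Import numFieldTopology.Exports.
Local Open Scope ring_scope.

Definition is_pmf {R : realType} {T : finType} (p : T -> R) : Prop :=
  (forall t, 0 <= p t) /\ \sum_t p t = 1.

(* Kullback-Leibler divergence D(p||q) (natural log), with 0 ln(0/q) = 0
   and D = +oo when p is not absolutely continuous w.r.t. q. *)
Definition KLdiv {R : realType} {T : finType} (p q : T -> R) : \bar R :=
  if [exists t, (0 < p t) && (q t == 0)] then +oo%E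
  else (\sum_t p t * ln (p t / q t))%:E.

Definition mutinf {R : realType} {A B : finType} (p : A -> B -> R) : R :=
  \sum_a \sum_b p a b * ln (p a b / ((\sum_b' p a b') * (\sum_a' p a' b))).

Definition condmutinf {R : realType} {A B C : finType} (p : A -> B -> C -> R) : R :=
  \sum_a \sum_b \sum_c p a b c *
    ln (p a b c * (\sum_a' \sum_b' p a' b' c) /
        ((\sum_b' p a b' c) * (\sum_a' p a' b c))).

Definition markov {R : realType} {A B C : finType} (p : A -> B -> C -> R) : Prop :=
  forall a b c,
    p a b c * (\sum_a' \sum_c' p a' b c') = (\sum_c' p a b c') * (\sum_a' p a' b c).

Section Aux.
Variables (R : realType) (X Y1 Y2 U V : finType).
Variable Q : U -> V -> X -> Y1 -> Y2 -> R.

Definition QX x := \sum_u \sum_v \sum_y1 \sum_y2 Q u v x y1 y2.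
Definition QUX u x := \sum_v \sum_y1 \sum_y2 Q u v x y1 y2.
Definition QUY1 u y1 := \sum_v \sum_x \sum_y2 Q u v x y1 y2.
Definition QUVY1 u v y1 := \sum_x \sum_y2 Q u v x y1 y2.
Definition QUVY2 u v y2 := \sum_x \sum_y1 Q u v x y1 y2.

(* conditional pmfs P_{U|X} and P_{V|Y1 U} (set to 0 off the support;
   this arbitrary choice does not affect any quantity in the theorem) *)
Definition PU_X u x := QUX u x / QX x.
Definition PV_Y1U v y1 u := QUVY1 u v y1 / QUY1 u y1.

Definition in_S (P : X -> Y1 -> Y2 -> R) (R1 R2 : R) : Prop :=
  is_pmf (fun w : U * V * X * Y1 * Y2 => Q w.1.1.1.1 w.1.1.1.2 w.1.1.2 w.1.2 w.2)
  /\ (forall x y1 y2, \sum_u \sum_v Q u v x y1 y2 = P x y1 y2)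
  /\ markov (fun (u : U) (x : X) (y : Y1 * Y2) => \sum_v Q u v x y.1 y.2)
  /\ markov (fun (v : V) (b : Y1 * U) (c : Y2 * X) => Q b.2 v c.2 b.1 c.1)
  /\ mutinf QUX <= R1
  /\ condmutinf (fun v y1 u => QUVY1 u v y1) <= R2.

Definition Qbar (Pbar : X -> Y1 -> Y2 -> R) u v x y1 y2 :=
  Pbar x y1 y2 * PU_X u x * PV_Y1U v y1 u.

Definition in_L1 (t : U -> X -> Y1 -> R) : Prop :=
  is_pmf (fun w : U * X * Y1 => t w.1.1 w.1.2 w.2)
  /\ (forall u x, \sum_y1 t u x y1 = QUX u x)
  /\ (forall u y1, \sum_x t u x y1 = QUY1 u y1).

Definition in_L2 (t : U -> V -> X -> Y1 -> Y2 -> R) : Prop :=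
  is_pmf (fun w : U * V * X * Y1 * Y2 => t w.1.1.1.1 w.1.1.1.2 w.1.1.2 w.1.2 w.2)
  /\ (forall u x, \sum_v \sum_y1 \sum_y2 t u v x y1 y2 = QUX u x)
  /\ (forall u v y1, \sum_x \sum_y2 t u v x y1 y2 = QUVY1 u v y1)
  /\ (forall u v y2, \sum_x \sum_y1 t u v x y1 y2 = QUVY2 u v y2).

Definition div1 (Pbar : X -> Y1 -> Y2 -> R) (t : U -> X -> Y1 -> R) : \bar R :=
  KLdiv (fun w : U * X * Y1 => t w.1.1 w.1.2 w.2)
        (fun w : U * X * Y1 =>
           \sum_v \sum_y2 Qbar Pbar w.1.1 v w.1.2 w.2 y2).

Definition div2 (Pbar : X -> Y1 -> Y2 -> R) (t : U -> V -> X -> Y1 -> Y2 -> R)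
  : \bar R :=
  KLdiv (fun w : U * V * X * Y1 * Y2 => t w.1.1.1.1 w.1.1.1.2 w.1.1.2 w.1.2 w.2)
        (fun w : U * V * X * Y1 * Y2 =>
           Qbar Pbar w.1.1.1.1 w.1.1.1.2 w.1.1.2 w.1.2 w.2).
End Aux.

(* the two hypotheses: H1 = null, H2 = alternative *)
Inductive hyp := H1 | H2.
Definition isH1 h := if h is H1 then true else false.
Definition isH2 h := if h is H2 then true else false.

(* A code of blocklength n.  Messages in {1,..,||phi||} are represented by
   'I_||phi|| = {0,..,||phi||-1}. *)
Record code (X Y1 Y2 : finType) (n : nat) := Code {
  size1 : nat;
  size2 : nat;
  enc1 : {ffun 'I_n -> X} -> 'I_size1;
  enc2 : 'I_size1 -> {ffun 'I_n -> Y1} -> 'I_size2;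
  dec1 : 'I_size1 -> {ffun 'I_n -> Y1} -> hyp;
  dec2 : 'I_size1 -> 'I_size2 -> {ffun 'I_n -> Y2} -> hyp
}.

Section Codes.
Variables (R : realType) (X Y1 Y2 : finType).

Definition iid_prob (n : nat) (P : X -> Y1 -> Y2 -> R)
  (E : {ffun 'I_n -> X} -> {ffun 'I_n -> Y1} -> {ffun 'I_n -> Y2} -> bool) : R :=
  \sum_(x : {ffun 'I_n -> X}) \sum_(y1 : {ffun 'I_n -> Y1})
    \sum_(y2 : {ffun 'I_n -> Y2})
      (\prod_(t < n) P (x t) (y1 t) (y2 t)) * (E x y1 y2)%:R.

Variables (P Pbar : X -> Y1 -> Y2 -> R).

Definition dec1_out n (c : code X Y1 Y2 n) x y1 := dec1 (enc1 c x) y1.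
Definition dec2_out n (c : code X Y1 Y2 n) x y1 y2 :=
  dec2 (enc1 c x) (enc2 (enc1 c x) y1) y2.

Definition alpha1 n (c : code X Y1 Y2 n) :=
  iid_prob P (fun x y1 _ => isH2 (dec1_out c x y1)).
Definition beta1 n (c : code X Y1 Y2 n) :=
  iid_prob Pbar (fun x y1 _ => isH1 (dec1_out c x y1)).
Definition alpha2 n (c : code X Y1 Y2 n) :=
  iid_prob P (fun x y1 y2 => isH2 (dec2_out c x y1 y2)).
Definition beta2 n (c : code X Y1 Y2 n) :=
  iid_prob Pbar (fun x y1 y2 => isH1 (dec2_out c x y1 y2)).

Definition neglog_rate (n : nat) (b : R) : \bar R :=
  if b == 0 then +oo%E else (- ln b / n%:R)%:E.

Definition achievable (R1 R2 eps1 eps2 : R) (th : R * R) : Prop :=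
  exists c : forall n, code X Y1 Y2 n,
    (limn_esup (fun n => (alpha1 (c n))%:E) <= eps1%:E)%E
 /\ (limn_esup (fun n => (alpha2 (c n))%:E) <= eps2%:E)%E
 /\ (th.1%:E <= limn_einf (fun n => neglog_rate n (beta1 (c n))))%E
 /\ (th.2%:E <= limn_einf (fun n => neglog_rate n (beta2 (c n))))%E
 /\ (limn_esup (fun n => (ln (size1 (c n))%:R / n%:R)%:E) <= R1%:E)%E
 /\ (limn_esup (fun n => (ln (size2 (c n))%:R / n%:R)%:E) <= R2%:E)%E.

Definition region (R1 R2 eps1 eps2 : R) : set (R * R) :=
  @closure (R * R)%type [set th | achievable R1 R2 eps1 eps2 th].
End Codes.

(* Main.v *)
(* Random codebooks are replaced by a greedy derandomisation of rejection sampling: if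
   codewords drawn from q are accepted with probability W(a,b)/(K q(b)), the first accepted
   one is distributed like the channel W, so about K codewords simulate W up to a factor 2
   and the mass where W > K q. Because costs are averaged linearly, each codeword can be
   chosen deterministically, and each source word may simply take its cheapest codeword.
   Used twice, with K = exp(n(I(U;X)+d)) and K = exp(n(I(V;Y1|U)+d)), this makes the
   joint law of (U,V,X,Y1,Y2)^n under the null hypothesis dominate the error, and the weak law
   of large numbers makes it vanish; no Markov lemma is needed.
   For the exponents, given a codeword a the alternative probability of the b such that (a,b)
   has type t is at most exp(-n F(t)), where F(t) = D(t || t_A Pbar), and F(t) equals
   D(t || Qbar) plus the rates of the codebooks, which is what the union bound over codewords
   loses. There are polynomially many types, and compactness of the simplex turns the approximate marginal
   constraints of typicality into the exact ones of L1 and L2. Finally a diagonal choice of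
   codes removes all slacks, so that the pair is achievable even before taking the closure. *)
Require Import Defs.
From HB Require Import structures.
From mathcomp Require Import all_boot all_order all_algebra.
From mathcomp Require Import all_classical all_reals all_analysis.
From mathcomp Require Import ring lra.
Import Order.TTheory GRing.Theory Num.Theory.
Import numFieldNormedType.Exports.
Local Open Scope ring_scope.
Set Implicit Arguments.
Unset Strict Implicit.
Unset Printing Implicit Defensive.

(** * Greedy covering *)

Section Covering.
Variable R : realType.

(** The maximiser of [g] works. Since [g] is nonnegative, the weights [q] may have total mass below
    1. *)
Lemma exists_ge_mean (B : finType) (b0 : B) (q g : B -> R) :
  (forall b, 0 <= q b) -> \sum_b q b <= 1 -> (forall b, 0 <= g b) ->
  exists b, \sum_b' q b' * g b' <= g b.
Proof.
move=> q0 q1 g0.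
have [b _ bmax] := arg_maxP (fun b => g b : R) (isT : xpredT b0).
exists b; apply: (@le_trans _ _ ((\sum_b' q b') * g b)); last by rewrite ler_piMl.
by rewrite mulr_suml ler_sum // => b' _; apply: ler_wpM2l => //; exact: bmax.
Qed.

(** [None] means that no codeword is used for [a], at the fallback cost [h a]. *)
Definition pick_cost (A B : Type) (c : A -> B -> R) (h : A -> R)
    (f : A -> option B) (a : A) : R :=
  if f a is Some b then c a b else h a.

Variables (A B : finType) (b0 : B) (q : B -> R) (W : A -> B -> R) (K : R).
Hypotheses (q_ge0 : forall b, 0 <= q b) (q_le1 : \sum_b q b <= 1) (K_gt0 : 0 < K).
Hypotheses (W_ge0 : forall a b, 0 <= W a b) (W_le : forall a b, W a b <= K * q b).

(** The probability that a single codeword drawn from [q] is accepted for [a]. *)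
Let r a := (\sum_b W a b) / K.

Let r_ge0 a : 0 <= r a.
Proof. by rewrite divr_ge0 ?sumr_ge0 // ltW. Qed.

Let r_le1 a : r a <= 1.
Proof.
rewrite ler_pdivrMr // mul1r (@le_trans _ _ (K * \sum_b q b)) //; last by rewrite ler_piMr // ltW.
by rewrite mulr_sumr ler_sum.
Qed.

(* The acceptance probability of rejection sampling; the convention x / 0 = 0
   makes it vanish when q b = 0. *)
Let acc a b := W a b / (K * q b).

Let acc_bounds a b : 0 <= acc a b <= 1.
Proof.
have Kq : 0 <= K * q b by rewrite mulr_ge0 // ltW.
rewrite /acc divr_ge0 //=; have [->|ne] := eqVneq (K * q b) 0; first by rewrite invr0 mulr0.
by rewrite ler_pdivrMr ?mul1r // lt0r ne.
Qed.

Let q_acc a b : q b * acc a b = W a b / K.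
Proof.
have [qb|qb] := eqVneq (q b) 0.
  have -> : W a b = 0 by apply/le_anti; rewrite W_ge0 andbT (le_trans (W_le a b)) // qb mulr0.
  by rewrite qb !mul0r.
by rewrite /acc; field; rewrite qb gt_eqF.
Qed.

(* One codeword beats the average over a random codeword accepted with
   probability [acc], since the minimum is below every mixture. *)
Let greedy_step (w h : A -> R) (c : A -> B -> R) : (forall a, 0 <= w a) ->
  exists b, \sum_a w a * Num.min (c a b) (h a)
    <= \sum_a w a * ((1 - r a) * h a + (\sum_b W a b * c a b) / K).
Proof.
move=> w0.
(* The averaging is applied to savings rather than costs: the saving over the fallback is
   nonnegative, and it is at least the saving of any randomised acceptance rule. *)
have [|b bP] := exists_ge_mean b0 (g := fun b => \sum_a w a * (h a - Num.min (c a b) (h a))) q_ge0 q_le1.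
  by move=> b; apply: sumr_ge0 => a _; rewrite mulr_ge0 // subr_ge0 ge_min lexx orbT.
exists b.
suff lb : \sum_a w a * h a - \sum_a w a * ((1 - r a) * h a + (\sum_b W a b * c a b) / K)
    <= \sum_a w a * (h a - Num.min (c a b) (h a)).
  have e : \sum_a w a * (h a - Num.min (c a b) (h a)) =
      \sum_a w a * h a - \sum_a w a * Num.min (c a b) (h a).
    by rewrite -sumrB; apply: eq_bigr => a _; rewrite mulrBr.
  by rewrite e in lb; lra.
apply: le_trans bP.
under [leRHS]eq_bigr do rewrite mulr_sumr.
rewrite exchange_big /= -sumrB; apply: ler_sum => a _.
have -> : w a * h a - w a * ((1 - r a) * h a + (\sum_b W a b * c a b) / K) =
    \sum_b' w a * (q b' * acc a b' * (h a - c a b')).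
  rewrite -mulr_sumr; under [X in _ = _ * X]eq_bigr do rewrite q_acc mulrAC mulrBr.
  rewrite -mulr_suml big_split /= sumrN -mulr_suml /r.
  by field; rewrite gt_eqF.
apply: ler_sum => b' _; rewrite [leRHS]mulrCA ler_wpM2l // -mulrA ler_wpM2l //.
have /andP[a0 a1] := acc_bounds a b'.
case: (leP (c a b') (h a)) => hc.
  by rewrite ler_piMl // subr_ge0.
by rewrite subrr mulr_ge0_le0 // subr_le0 ltW.
Qed.

(** The new codeword is chosen first, with [a] weighted by [(1 - r a) ^+ m], the probability that
    the [m] remaining draws all reject. The other codewords come from the induction hypothesis,
    whose fallback cost is now the minimum of [h] and the cost of the new codeword. *)
Let greedy (m : nat) (c : A -> B -> R) (h : A -> R) :
  exists (s : seq B) (f : A -> option B),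
    [/\ size s = m, forall a b, f a = Some b -> b \in s &
    \sum_a pick_cost c h f a <= \sum_a ((1 - r a) ^+ m * h a +
      (\sum_b W a b * c a b) / K * \sum_(j < m) (1 - r a) ^+ j)].
Proof.
elim: m h => [|m IH] h.
  exists [::], (fun=> None); split=> //; apply: ler_sum => a _.
  by rewrite /pick_cost expr0 mul1r big_ord0 mulr0 addr0.
have [|b bP] := @greedy_step (fun a => (1 - r a) ^+ m) h c.
  by move=> a; rewrite exprn_ge0 // subr_ge0.
have [s [f [sm fs H]]] := IH (fun a => Num.min (c a b) (h a)).
exists (b :: s), (fun a => if f a is Some b' then Some b' else if c a b <= h a then Some b else None).
split; first by rewrite /= sm.
  move=> a b'; case E: (f a) => [b1|]; first by move=> [<-]; rewrite inE (fs _ _ E) orbT.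
  by case: ifP => // _ [<-]; rewrite mem_head.
rewrite (eq_bigr (pick_cost c (fun a => Num.min (c a b) (h a)) f)); last first.
  move=> a _; rewrite /pick_cost; case: (f a) => // .
  by case: leP => // /ltW; case: leP.
apply: (le_trans H); rewrite big_split /= [leRHS](_ : _ =
  \sum_a (1 - r a) ^+ m * ((1 - r a) * h a + (\sum_b W a b * c a b) / K)
  + \sum_a (\sum_b W a b * c a b) / K * \sum_(j < m) (1 - r a) ^+ j).
  by rewrite lerD2r.
rewrite -big_split /=; apply: eq_bigr => a _; rewrite big_ord_recr /= exprSr.
ring.
Qed.

(* The first term is the cost under the channel [W] itself; the second one charges the
   full cost [h] to the failures of the sampler and to the mass missing from [W]. *)
Lemma covering (m : nat) (k : R) (c : A -> B -> R) (h : A -> R) :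
  expR (- (m%:R / (2 * K))) <= k ->
  (forall a, \sum_b W a b <= 1) ->
  (forall a b, 0 <= c a b) -> (forall a, 0 <= h a) ->
  exists (s : seq B) (f : A -> option B),
    [/\ size s = m, forall a b, f a = Some b -> b \in s &
    \sum_a pick_cost c h f a <= \sum_a (2 * (\sum_b W a b * c a b)
      + (k + 2 * (1 - \sum_b W a b)) * h a)].
Proof.
move=> km W1 c0 h0.
(* Truncation at [h] gives the bound [Ch] used in the case of small mass. It is harmless because a
   codeword dearer than [h] is replaced by [None]. *)
pose c' a b := Num.min (c a b) (h a).
have c'0 a b : 0 <= c' a b by rewrite le_min c0 h0.
have k0 : 0 <= k := le_trans (expR_ge0 _) km.
have [s [f [sm fs H]]] := greedy m c' h.
exists s, (fun a => if f a is Some b then if c a b <= h a then Some b else None else None).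
split=> //.
  by move=> a b; case E: (f a) => [b1|] //; case: ifP => // _ [<-]; exact: fs E.
rewrite (eq_bigr (pick_cost c' h f)); last first.
  by move=> a _; rewrite /pick_cost /c'; case: (f a) => // b; case: leP.
apply: (le_trans H); apply: ler_sum => a _.
set S := \sum_(j < m) _; set C := \sum_b W a b * c' a b.
have C0 : 0 <= C by apply: sumr_ge0 => b _; rewrite mulr_ge0.
have Cc : C <= \sum_b W a b * c a b.
  by apply: ler_sum => b _; rewrite ler_wpM2l // ge_min lexx.
have S0 : 0 <= S by apply: sumr_ge0 => j _; rewrite exprn_ge0 // subr_ge0.
have rS : r a * S = 1 - (1 - r a) ^+ m.
  by rewrite -{1}(subKr 1 (r a)) -opprB mulNr -subrX1 opprB.
have W0 : 0 <= \sum_b W a b by apply: sumr_ge0.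
have rK : \sum_b W a b = r a * K by rewrite /r divfK // gt_eqF.
have x0 : 0 <= (1 - r a) ^+ m by rewrite exprn_ge0 // subr_ge0.
(* If [W a] has mass at least 1/2, then [r a] is at least [1 / (2 * K)]: the geometric sum [S] is at
   most [2 * K], whence the factor 2, and the failure probability is at most [k]. Otherwise the
   total cost is at most [h a], which the term for missing mass already pays, as [2 * (1 - mass)]
   exceeds 1. *)
have [s2|s2] := leP (1 / 2) (\sum_b W a b).
  rewrite addrC; apply: lerD.
    apply: (@le_trans _ _ (2 * C)); last by rewrite ler_pM2l.
    rewrite [leRHS]mulrC -mulrA ler_wpM2l // ler_pdivrMl //.
    rewrite rK in s2; rewrite rK in W0.
    have : r a * S <= 1 by rewrite rS; lra.
    have := ler_wpM2r S0 s2; have := ltW K_gt0.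
    nra.
  apply: ler_wpM2r => //; apply: (@le_trans _ _ k); last by rewrite lerDl mulr_ge0 // subr_ge0.
  apply: le_trans km.
  rewrite -(mulrN m%:R) expRM_natl.
  apply: lerXn2r; rewrite ?nnegrE ?expR_ge0 ?subr_ge0 //.
  apply: le_trans (expR_ge1Dx _); rewrite lerD2l lerN2 /r ler_pdivlMr //.
  have -> : (2 * K)^-1 * K = 1 / 2 by field; rewrite gt_eqF.
  by [].
have Ch : C / K <= r a * h a.
  rewrite /r mulrAC ler_wpM2r ?invr_ge0 ?(ltW K_gt0) // /C mulr_suml; apply: ler_sum => b _.
  by rewrite ler_wpM2l // ge_min lexx orbT.
have -> : (1 - r a) ^+ m = 1 - r a * S by rewrite rS; ring.
have := ler_wpM2r S0 Ch.
have : 0 <= \sum_b W a b * c a b by apply: sumr_ge0 => b _; rewrite mulr_ge0.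
have := mulr_ge0 k0 (h0 a).
have : (\sum_b W a b) * h a <= 1/2 * h a by rewrite ler_wpM2r // ltW.
lra.
Qed.
End Covering.

(** * Two nested codebooks *)

Section TwoStage.
Variables (R : realType) (X Y1 Y2 U V : finType) (u0 : U) (v0 : V).
Variables (p : X -> Y1 -> Y2 -> R) (q1 : U -> R) (w1 : X -> U -> R)
  (q2 : U -> V -> R) (w2 : U -> Y1 -> V -> R) (good : U -> V -> X -> Y1 -> Y2 -> bool).

Definition joint (u : U) (v : V) (x : X) (y1 : Y1) (y2 : Y2) : R :=
  p x y1 y2 * w1 x u * w2 u y1 v.

Definition joint_prob (E : U -> V -> X -> Y1 -> Y2 -> bool) : R :=
  \sum_x \sum_y1 \sum_y2 \sum_u \sum_v joint u v x y1 y2 * (E u v x y1 y2)%:R.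

(** The conditions [w1_full] and [w2_full] ask the channels to be stochastic only where the source
    has mass, because conditional pmfs are set to 0 off the support. *)
Hypotheses (p_ge0 : forall x y1 y2, 0 <= p x y1 y2)
  (q1_ge0 : forall u, 0 <= q1 u) (q1_le1 : \sum_u q1 u <= 1)
  (q2_ge0 : forall u v, 0 <= q2 u v) (q2_le1 : forall u, \sum_v q2 u v <= 1)
  (w1_ge0 : forall x u, 0 <= w1 x u) (w1_le1 : forall x, \sum_u w1 x u <= 1)
  (w2_ge0 : forall u y1 v, 0 <= w2 u y1 v) (w2_le1 : forall u y1, \sum_v w2 u y1 v <= 1)
  (p_le1 : \sum_x \sum_y1 \sum_y2 p x y1 y2 <= 1)
  (w1_full : forall x y1 y2, p x y1 y2 * (\sum_u w1 x u) = p x y1 y2)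
  (w2_full : forall x y1 y2 u,
     p x y1 y2 * w1 x u * (\sum_v w2 u y1 v) = p x y1 y2 * w1 x u).
Variables (K1 K2 k : R) (m1 m2 : nat).
Hypotheses (K1_gt0 : 0 < K1) (K2_gt0 : 0 < K2)
  (k1 : expR (- (m1%:R / (2 * K1))) <= k) (k2 : expR (- (m2%:R / (2 * K2))) <= k).

(** The channels cut down to where rejection sampling is possible, that is, where their density with
    respect to the codeword law is at most [K1] or [K2]. *)
Let W1 x u := w1 x u * (w1 x u <= K1 * q1 u)%R%:R.
Let W2 u y1 v := w2 u y1 v * (w2 u y1 v <= K2 * q2 u v)%R%:R.

Let sum_option (f : X -> option U) (a : X -> U -> R) (b : X -> R) :
  \sum_x (if f x is Some u then a x u else b x) =
  \sum_x (f x == None)%:R * b x + \sum_u \sum_x (f x == Some u)%:R * a x u.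
Proof.
rewrite exchange_big -big_split /=; apply: eq_bigr => x _; case: (f x) => [u|] /=.
  rewrite mul0r add0r (bigD1 u) //= eqxx mul1r big1 ?addr0 // => u' ne.
  by rewrite (_ : (Some u == Some u') = false) ?mul0r //; apply/eqP => -[e]; rewrite e eqxx in ne.
by rewrite mul1r big1 ?addr0 // => u _; rewrite mul0r.
Qed.

Let W1_ge0 x u : 0 <= W1 x u. Proof. by rewrite mulr_ge0 // ler0n. Qed.
Let W2_ge0 u y1 v : 0 <= W2 u y1 v. Proof. by rewrite mulr_ge0 // ler0n. Qed.
Let W1_lew x u : W1 x u <= w1 x u. Proof. by rewrite ler_piMr // lern1 leq_b1. Qed.
Let W2_lew u y1 v : W2 u y1 v <= w2 u y1 v. Proof. by rewrite ler_piMr // lern1 leq_b1. Qed.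
Let W1_le x u : W1 x u <= K1 * q1 u.
Proof.
rewrite /W1; case: (boolP (w1 x u <= K1 * q1 u)) => [|_]; rewrite ?mulr1 // mulr0.
by rewrite mulr_ge0 // ltW.
Qed.
Let W2_le u y1 v : W2 u y1 v <= K2 * q2 u v.
Proof.
rewrite /W2; case: (boolP (w2 u y1 v <= K2 * q2 u v)) => [|_]; rewrite ?mulr1 // mulr0.
by rewrite mulr_ge0 // ltW.
Qed.
Let W1_le1 x : \sum_u W1 x u <= 1.
Proof. by apply: le_trans (w1_le1 x); apply: ler_sum. Qed.
Let W2_le1 u y1 : \sum_v W2 u y1 v <= 1.
Proof. by apply: le_trans (w2_le1 u y1); apply: ler_sum. Qed.
Let k_ge0 : 0 <= k := le_trans (expR_ge0 _) k1.

(* the cost of sending codeword [u] for source [x], averaged over the second stage *)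
Let c1 x u := \sum_y1 \sum_y2 p x y1 y2 *
  (2 * (\sum_v W2 u y1 v * (~~ good u v x y1 y2)%:R) + (k + 2 * (1 - \sum_v W2 u y1 v))).
Let h1 x := \sum_y1 \sum_y2 p x y1 y2.

Let c1_ge0 x u : 0 <= c1 x u.
Proof.
do 2![apply: sumr_ge0 => ? _]; rewrite mulr_ge0 // addr_ge0 //.
  by rewrite mulr_ge0 // sumr_ge0 // => v _; rewrite mulr_ge0 // ler0n.
by rewrite addr_ge0 // mulr_ge0 // subr_ge0.
Qed.

Let d1 (u : U) (_ : V) x (_ : Y1) (_ : Y2) := ~~ (w1 x u <= K1 * q1 u).
Let d2 u v (_ : X) y1 (_ : Y2) := ~~ (w2 u y1 v <= K2 * q2 u v).
Let bad u v x y1 y2 := ~~ good u v x y1 y2.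

(** The mass cut from the first channel is charged to the event [d1]; [w2_full] makes the sum over
    [v] in the joint law collapse. *)
Let W1_deficit : \sum_x (1 - \sum_u W1 x u) * h1 x <= joint_prob d1.
Proof.
apply: ler_sum => x _; rewrite /h1 mulr_sumr; apply: ler_sum => y1 _.
rewrite mulr_sumr; apply: ler_sum => y2 _.
rewrite mulrC mulrBr mulr1 -{1}w1_full -mulrBr -sumrB mulr_sumr; apply: ler_sum => u _.
rewrite /joint /d1; under eq_bigr do rewrite mulrAC.
rewrite -mulr_sumr mulrAC w2_full /W1.
by case: (w1 x u <= _); rewrite /= ?mulr1 ?mulr0 ?subrr ?subr0 ?mulr0.
Qed.

Let c1_mean : \sum_x \sum_u w1 x u * c1 x u <= 2 * joint_prob bad + k + 2 * joint_prob d2.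
Proof.
have w1_mass : \sum_x \sum_y1 \sum_y2 \sum_u p x y1 y2 * w1 x u <= 1.
  apply: le_trans p_le1; do 3![apply: ler_sum => ? _].
  by rewrite -mulr_sumr w1_full.
apply: (@le_trans _ _ (2 * joint_prob bad
    + k * (\sum_x \sum_y1 \sum_y2 \sum_u p x y1 y2 * w1 x u) + 2 * joint_prob d2)); last first.
  by rewrite lerD2r lerD2l ler_piMr.
rewrite !mulr_sumr -!big_split /=; apply: ler_sum => x _.
under eq_bigr do rewrite mulr_sumr; rewrite exchange_big /=.
rewrite !mulr_sumr -!big_split /=; apply: ler_sum => y1 _.
under eq_bigr do rewrite mulr_sumr; rewrite exchange_big /=.
rewrite !mulr_sumr -!big_split /=; apply: ler_sum => y2 _.
rewrite !mulr_sumr -!big_split /=; apply: ler_sum => u _.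
rewrite mulrCA mulrA mulrDr [X in _ + X <= _]mulrDr.
have pw : 0 <= p x y1 y2 * w1 x u by rewrite mulr_ge0.
rewrite addrA; apply: lerD; first apply: lerD.
- rewrite mulrCA ler_pM2l // mulr_sumr; apply: ler_sum => v _.
  by rewrite /joint -[leRHS]mulrA ler_wpM2l // ler_wpM2r // ler0n.
- by rewrite mulrC.
- rewrite mulrCA ler_pM2l // mulrBr mulr1 -{1}w2_full -mulrBr -sumrB mulr_sumr.
  apply: ler_sum => v _; rewrite /joint /d2 -[leRHS]mulrA ler_wpM2l // /W2.
  by case: (w2 u y1 v <= _); rewrite /= ?mulr1 ?mulr0 ?subrr ?subr0.
Qed.

(** The first covering uses as its cost [c1] the bound that the second covering will guarantee, so
    the two stages compose. They turn [bad] and [d2] into 2 * 2 times their probability and [d1]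
    into twice its own; [k] enters twice through [c1_mean] and once directly. *)
Lemma two_stage_code :
  exists (s1 : seq U) (f1 : X -> option U) (s2 : U -> seq V) (f2 : U -> Y1 -> option V),
    [/\ size s1 = m1, forall x u, f1 x = Some u -> u \in s1,
        forall u, size (s2 u) = m2, forall u y1 v, f2 u y1 = Some v -> v \in s2 u &
    \sum_x \sum_y1 \sum_y2 p x y1 y2 *
      (~~ (if f1 x is Some u then
             if f2 u y1 is Some v then good u v x y1 y2 else false
           else false))%:R
    <= 4 * joint_prob bad + 4 * joint_prob d2 + 2 * joint_prob d1 + 3 * k].
Proof.
have h1_ge0 x : 0 <= h1 x by do 2![apply: sumr_ge0 => ? _].
have [s1 [f1 [sz1 f1s H1]]] :=
  covering u0 q1_ge0 q1_le1 K1_gt0 W1_ge0 W1_le k1 W1_le1 c1_ge0 h1_ge0.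
(* With [f1] fixed, the second codebook attached to [u] only has to serve the source words encoded
   as [u]. *)
pose c2 u y1 v := \sum_x \sum_y2 (f1 x == Some u)%:R * p x y1 y2 * (bad u v x y1 y2)%:R.
pose h2 u y1 := \sum_x \sum_y2 (f1 x == Some u)%:R * p x y1 y2.
have /choice[s2 /choice[f2 H2]] u : exists (s : seq V) (f : Y1 -> option V),
    [/\ size s = m2, forall a b, f a = Some b -> b \in s &
    \sum_y1 pick_cost (c2 u) (h2 u) f y1 <= \sum_y1 (2 * (\sum_v W2 u y1 v * c2 u y1 v)
      + (k + 2 * (1 - \sum_v W2 u y1 v)) * h2 u y1)].
  apply: (covering v0 (q2_ge0 u) (q2_le1 u) K2_gt0 (W2_ge0 u) (W2_le u) k2 (W2_le1 u)).
    by move=> y1 v; do 2![apply: sumr_ge0 => ? _]; rewrite !mulr_ge0 // ler0n.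
  by move=> y1; do 2![apply: sumr_ge0 => ? _]; rewrite !mulr_ge0 // ler0n.
exists s1, f1, s2, f2; split=> //; try by move=> u; case: (H2 u).
apply: (@le_trans _ _ (\sum_x pick_cost c1 h1 f1 x)).
  rewrite /pick_cost sum_option.
  rewrite (eq_bigr (fun x => if f1 x is Some u then
     \sum_y1 \sum_y2 p x y1 y2 * (~~ (if f2 u y1 is Some v then good u v x y1 y2 else false))%:R
     else h1 x)); last first.
    move=> x _; case: (f1 x) => // ; apply: eq_bigr => y1 _; apply: eq_bigr => y2 _.
    by rewrite mulr1.
  rewrite sum_option lerD2l; apply: ler_sum => u _.
  have [_ _ Hu] := H2 u.
  rewrite [leRHS](_ : _ = \sum_y1 (2 * (\sum_v W2 u y1 v * c2 u y1 v)
      + (k + 2 * (1 - \sum_v W2 u y1 v)) * h2 u y1)); last first.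
    rewrite /c1; under eq_bigr do rewrite mulr_sumr; rewrite exchange_big /=.
    apply: eq_bigr => y1 _.
    have -> : \sum_v W2 u y1 v * c2 u y1 v = \sum_x \sum_y2
        (f1 x == Some u)%:R * p x y1 y2 * (\sum_v W2 u y1 v * (bad u v x y1 y2)%:R).
      under eq_bigr do rewrite mulr_sumr; rewrite exchange_big /=; apply: eq_bigr => x _.
      under eq_bigr do rewrite mulr_sumr; rewrite exchange_big /=; apply: eq_bigr => y2 _.
      by rewrite mulr_sumr; apply: eq_bigr => v _; rewrite mulrCA.
    rewrite /h2 !mulr_sumr -big_split /=; apply: eq_bigr => x _.
    rewrite !mulr_sumr -big_split /=; apply: eq_bigr => y2 _.
    ring.
  apply: le_trans Hu.
  under eq_bigr do rewrite mulr_sumr; rewrite exchange_big /=; apply: ler_sum => y1 _.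
  rewrite /pick_cost; case: (f2 u y1) => [v|]; rewrite ?/c2 ?/h2; apply: ler_sum => x _;
    rewrite mulr_sumr; apply: ler_sum => y2 _; by rewrite mulrA // mulr1.
apply: (le_trans H1).
rewrite big_split /= -mulr_sumr.
have A1 : \sum_x \sum_u W1 x u * c1 x u <= \sum_x \sum_u w1 x u * c1 x u.
  by do 2![apply: ler_sum => ? _]; rewrite ler_wpM2r.
have A2 : \sum_x (k + 2 * (1 - \sum_u W1 x u)) * h1 x <= k + 2 * joint_prob d1.
  under eq_bigr do rewrite mulrDl -mulrA; rewrite big_split /= -!mulr_sumr.
  by apply: lerD; [rewrite ler_piMr | rewrite ler_pM2l].
have := c1_mean; lra.
Qed.

End TwoStage.

(** * Weak law of large numbers *)

Section Sequences.
Variable R : realType.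

Lemma sum_ffun_pair n (A B : finType) (F : {ffun 'I_n -> A} -> {ffun 'I_n -> B} -> R) :
  \sum_a \sum_b F a b =
  \sum_(w : {ffun 'I_n -> A * B}) F [ffun i => (w i).1] [ffun i => (w i).2].
Proof.
rewrite pair_bigA /= (reindex (fun w : {ffun 'I_n -> A * B} =>
  ([ffun i => (w i).1], [ffun i => (w i).2]))) //=.
exists (fun ab : {ffun 'I_n -> A} * {ffun 'I_n -> B} => [ffun i => (ab.1 i, ab.2 i)]) => [w _|[a b] _].
  by apply/ffunP => i; rewrite !ffunE -surjective_pairing.
by congr pair; apply/ffunP => i; rewrite !ffunE.
Qed.

Lemma sum_prod_ffun n (W : finType) (F : 'I_n -> W -> R) :
  \sum_(w : {ffun 'I_n -> W}) \prod_i F i (w i) = \prod_i \sum_x F i x.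
Proof. by rewrite bigA_distr_bigA. Qed.

Definition avg n (g : 'I_n -> R) : R := (\sum_i g i) / n%:R.

Lemma prod_pick n (i : 'I_n) (F : 'I_n -> R) :
  \prod_k (if k == i then F k else 1) = F i.
Proof. by rewrite -big_mkcond big_pred1_eq. Qed.

Variables (W : finType) (q : W -> R).
Hypothesis q_pmf : is_pmf q.

Lemma sum_prod_sqr n (h : W -> R) : \sum_x q x * h x = 0 ->
  \sum_(w : {ffun 'I_n -> W}) (\prod_i q (w i)) * (\sum_i h (w i)) ^+ 2
  = n%:R * \sum_x q x * h x ^+ 2.
Proof.
move=> h0; have [_ q1] := q_pmf.
transitivity (\sum_(i < n) \sum_(j < n) \sum_(w : {ffun 'I_n -> W})
    (\prod_k q (w k)) * (h (w i) * h (w j))).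
  under [RHS]eq_bigr do rewrite exchange_big /=.
  rewrite [RHS]exchange_big /=; apply: eq_bigr => w _.
  rewrite expr2 mulr_suml mulr_sumr; apply: eq_bigr => i _.
  by rewrite -mulr_sumr mulrA -mulrA -mulr_sumr.
(* A function of one coordinate is written as a product equal to 1 at all others, so that the
   expectation factors over coordinates. Off the diagonal a centred factor then gives 0. *)
have E i j : \sum_(w : {ffun 'I_n -> W}) (\prod_k q (w k)) * (h (w i) * h (w j)) =
    \prod_(k < n) \sum_x q x * ((if k == i then h x else 1) * (if k == j then h x else 1)).
  rewrite -sum_prod_ffun; apply: eq_bigr => w _.
  by rewrite !big_split /= !(prod_pick _ (fun k => h (w k))).
transitivity (\sum_(i < n) \sum_x q x * h x ^+ 2); last first.
  by rewrite sumr_const card_ord mulr_natl.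
apply: eq_bigr => i _; rewrite (bigD1 i) //= [X in _ + X]big1 => [|j ji].
  rewrite addr0 E (bigD1 i) //= eqxx [X in _ * X]big1 => [|k ki].
    by rewrite mulr1; apply: eq_bigr => x _; rewrite expr2.
  by rewrite (negbTE ki) -[RHS]q1; apply: eq_bigr => x _; rewrite !mulr1.
rewrite E (bigD1 i) //= eqxx eq_sym (negbTE ji).
by under eq_bigr do rewrite mulr1; rewrite h0 mul0r.
Qed.

Lemma chebyshev_iid n (g : W -> R) (e : R) : 0 < e -> (0 < n)%N ->
  \sum_(w : {ffun 'I_n -> W}) (\prod_i q (w i)) *
     (e < `|avg (fun i => g (w i)) - \sum_x q x * g x|)%R%:R
  <= (\sum_x q x * (g x - \sum_x q x * g x) ^+ 2) / (n%:R * e ^+ 2).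
Proof.
move=> e0 n0; have [q0 q1] := q_pmf; set mu := \sum_x q x * g x.
have n0R : 0 < n%:R :> R by rewrite ltr0n.
have h0 : \sum_x q x * (g x - mu) = 0.
  under eq_bigr do rewrite mulrBr; rewrite sumrB -mulr_suml q1 mul1r subrr //.
have -> : (\sum_x q x * (g x - mu) ^+ 2) / (n%:R * e ^+ 2) =
    (n%:R * \sum_x q x * (g x - mu) ^+ 2) / (n%:R * e) ^+ 2.
  by field; rewrite !gt_eqF.
rewrite -(sum_prod_sqr n h0) mulr_suml; apply: ler_sum => w _.
rewrite -mulrA ler_wpM2l ?prodr_ge0 //.
have -> : avg (fun i => g (w i)) - mu = (\sum_i (g (w i) - mu)) / n%:R.
  rewrite /avg sumrB sumr_const card_ord mulrBl -[mu *+ n]mulr_natr mulfK // gt_eqF //.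
case: ltP => [lt|_]; last by rewrite divr_ge0 ?sqr_ge0.
rewrite ler_pdivlMr ?mul1r ?exprn_gt0 ?mulr_gt0 // -[leRHS]real_normK ?num_real //.
rewrite lerXn2r ?nnegrE ?normr_ge0 ?mulr_ge0 ?ltW //.
by move: lt; rewrite normrM normfV (gtr0_norm n0R) ltr_pdivlMr // mulrC.
Qed.

Lemma weak_lln (g : W -> R) (e k : R) : 0 < e -> 0 < k ->
  \forall n \near \oo%classic, \sum_(w : {ffun 'I_n -> W}) (\prod_i q (w i)) *
     (e < `|avg (fun i => g (w i)) - \sum_x q x * g x|)%R%:R <= k.
Proof.
move=> e0 k0; set s := \sum_x q x * (g x - \sum_x q x * g x) ^+ 2.
near=> n.
have n0 : (0 < n)%N by near: n; exact: nbhs_infty_gt.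
apply: (le_trans (chebyshev_iid g e0 n0)); rewrite -/s.
rewrite ler_pdivrMr ?mulr_gt0 ?exprn_gt0 ?ltr0n // mulrCA.
rewrite -ler_pdivrMr ?mulr_gt0 ?exprn_gt0 //.
near: n; exact: nbhs_infty_ger.
Unshelve. all: by end_near. Qed.

End Sequences.

(** * Types and large deviations *)

Section Continuity.
Variable R : realType.

Lemma continuous_fsum (T : topologicalType) (I : finType) (F : I -> T -> R) :
  (forall i, continuous (F i)) -> continuous (fun x => \sum_i F i x).
Proof. by move=> cF; apply: continuous_big => //; exact: add_continuous. Qed.

(* Everywhere continuous because [ln] vanishes on nonpositive reals. *)
Lemma continuous_xlnx : continuous (fun x : R => x * ln x).
Proof.
move=> x; have [x0|x0|<-] := ltgtP 0 x.
- by apply: continuousM; [exact: cvg_id | exact: continuous_ln].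
- apply/cvgrPdist_le => e e0; near=> y.
  have y0 : y < 0 by near: y; exact: lt_nbhsl.
  by rewrite (ln0 (ltW y0)) (ln0 (ltW x0)) !mulr0 subrr normr0 ltW.
- apply/cvgrPdist_le => e e0; rewrite mul0r; near=> y; rewrite sub0r normrN.
  have [y0|y0] := leP y 0; first by rewrite ln0 // mulr0 normr0 ltW.
  have y1 : y < 1 by near: y; exact: lt_nbhsl.
  (* The bound [ln s < s] at [s = 1 / sqrt y] yields [|y * ln y| <= 2 * sqrt y], which is below [e]
     for such [y]. *)
  have ye : y < (e / 2) ^+ 2 by near: y; apply: lt_nbhsl; rewrite exprn_gt0 // divr_gt0.
  have s0 : 0 < Num.sqrt y by rewrite sqrtr_gt0.
  have se : Num.sqrt y < e / 2.
    by rewrite -(@ltr_pXn2r _ 2) ?nnegrE ?sqrtr_ge0 ?divr_ge0 ?(ltW e0) // sqr_sqrtr // ltW.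
  have ys : y = Num.sqrt y ^+ 2 by rewrite sqr_sqrtr // ltW.
  have lny : ln y = 2 * ln (Num.sqrt y) by rewrite [in LHS]ys lnXn // mulr_natl.
  have := ln_lt0 (x := y); rewrite y0 y1 => /(_ isT); rewrite lny => lns0.
  have H : y * - ln (Num.sqrt y) <= y * (Num.sqrt y)^-1.
    by rewrite ler_pM2l // -lnV ?posrE // ltW // ln_sublinear // invr_gt0.
  have ysE : y * (Num.sqrt y)^-1 = Num.sqrt y by rewrite {1}ys expr2 mulfK // gt_eqF.
  have H0 : y * (2 * ln (Num.sqrt y)) <= 0 by rewrite pmulr_rle0 // ltW.
  by rewrite ysE in H; rewrite ler0_norm //; lra.
Unshelve. all: by end_near. Qed.

(** This relaxes an exact constraint [G t <= 0] to an approximate one. On the compact set where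
    [F <= th - d], the function [G] is positive, so it has a positive minimum there, and half of
    this minimum is a valid tolerance. *)
Lemma compact_slack (T : topologicalType) (K : set T) (F G : T -> R) (th : R) :
  compact K -> continuous F -> continuous G ->
  (forall t, K t -> G t <= 0 -> th <= F t) ->
  forall d, 0 < d -> exists2 e, 0 < e & forall t, K t -> G t <= e -> th - d <= F t.
Proof.
move=> cK cF cG H d d0; set L := (K `&` [set t | F t <= th - d])%classic.
have cL : compact L.
  apply: compact_closedI => //.
  by move/continuous_closedP : cF => /(_ _ (@closed_le R (th - d))).
have [L0|/set0P L0] := eqVneq L set0.
  exists 1 => // t Kt _; rewrite leNgt; apply/negP => lt.
  by have : L t; [split => //; exact: ltW | rewrite L0].
have [c cL' cmin] := compact_EVT_min L0 cL (continuous_subspaceT cG).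
have [Kc Fc] : L c by exact/set_mem.
have Gc : 0 < G c.
  rewrite ltNge; apply/negP => /(H _ Kc) /le_trans /(_ Fc); rewrite lerBrDr.
  by rewrite gerDl leNgt d0.
exists (G c / 2); first by rewrite divr_gt0.
move=> t Kt Gt; rewrite leNgt; apply/negP => lt.
have : G c <= G t by apply: cmin; apply/mem_set; split => //; exact: ltW.
by move=> /le_trans/(_ Gt); lra.
Qed.

(** The simplex is closed in the cube, which is compact by Tychonoff for pointwise convergence. *)
Lemma compact_simplex (W : finType) :
  compact [set t : {ptws W -> R} | is_pmf (t : W -> R)]%classic.
Proof.
have ev (x : W) : continuous (fun f : {ptws W -> R} => f x : R).
  exact: (@proj_continuous W (fun=> R) x).
have cube : compact [set t : {ptws W -> R} | forall x, `[0, 1]%classic (t x)]%classic.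
  by apply: (@tychonoff W (fun=> R) (fun=> `[0, 1]%classic)) => _; exact: segment_compact.
apply: (subclosed_compact _ cube).
  have -> : [set t : {ptws W -> R} | is_pmf (t : W -> R)]%classic =
    ((\bigcap_(x in [set: W]) (fun t : {ptws W -> R} => t x) @^-1` [set y : R | 0 <= y]) `&`
    ((fun t : {ptws W -> R} => \sum_x t x) @^-1` [set 1]))%classic.
    by apply/seteqP; split => t /= [t0 t1]; split => // x; [move=> _; exact: t0 | exact: t0].
  apply: closedI.
    apply: closed_bigI => x _.
    by move/continuous_closedP : (ev x); apply; exact: closed_ge.
  by move/continuous_closedP : (continuous_fsum ev); apply; exact: closed_eq.
move=> t [t0 t1] x /=; rewrite in_itv /= t0 /= -t1 (bigD1 x) //= lerDl.
by rewrite sumr_ge0.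
Qed.

End Continuity.

Section Types.
Variable R : realType.

(** The type of the sequence [w]. *)
Definition emp n (W : finType) (w : {ffun 'I_n -> W}) (x : W) : R :=
  avg (fun i => (w i == x)%:R).

Lemma avg_emp n (W : finType) (w : {ffun 'I_n -> W}) (g : W -> R) :
  avg (fun i => g (w i)) = \sum_x emp w x * g x.
Proof.
rewrite /emp /avg; under [RHS]eq_bigr do rewrite mulrAC mulr_suml.
rewrite -mulr_suml exchange_big /=; congr (_ / _); apply: eq_bigr => i _.
rewrite (bigD1 (w i)) //= eqxx mul1r big1 ?addr0 // => x ne.
by rewrite eq_sym (negbTE ne) mul0r.
Qed.

Lemma emp_ge0 n (W : finType) (w : {ffun 'I_n -> W}) x : 0 <= emp w x.
Proof. by rewrite divr_ge0 // sumr_ge0 // => i _; rewrite ler0n. Qed.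

Lemma emp_gt0 n (W : finType) (w : {ffun 'I_n -> W}) i : 0 < emp w (w i).
Proof.
rewrite divr_gt0 ?ltr0n ?(leq_ltn_trans _ (ltn_ord i)) //.
by rewrite (bigD1 i) //= eqxx ltr_wpDr // sumr_ge0 // => j _; rewrite ler0n.
Qed.

Lemma emp_pmf n (W : finType) (w : {ffun 'I_n -> W}) : (0 < n)%N -> is_pmf (emp w).
Proof.
move=> n0; split; first exact: emp_ge0.
have := avg_emp w (fun=> 1); under [in RHS]eq_bigr do rewrite mulr1.
by move=> <-; rewrite /avg sumr_const card_ord divff // pnatr_eq0 -lt0n.
Qed.

Variables (A B : finType) (p : B -> R).
Hypothesis p_gt0 : forall b, 0 < p b.

(** The divergence of [t] from the product of its own [A]-marginal and [p]: the exponent of the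
    event that an independent sequence drawn from [p] has joint type [t] with a given codeword. *)
Definition cond_relent (t : A * B -> R) : R :=
  \sum_w t w * ln (t w / ((\sum_b t (w.1, b)) * p w.2)).

Definition zipf n (a : {ffun 'I_n -> A}) (b : {ffun 'I_n -> B}) : {ffun 'I_n -> A * B} :=
  [ffun i => (a i, b i)].

(* On a type class, [p] has density [exp (- n * cond_relent t)] with respect to the product
   of the conditional laws of [t], whose total mass is at most 1. *)
Lemma type_class_prob n (a : {ffun 'I_n -> A}) (t : A * B -> R) (C : pred {ffun 'I_n -> B}) :
  (forall b, C b -> emp (zipf a b) = t) -> (0 < n)%N ->
  \sum_(b | C b) \prod_i p (b i) <= expR (- (n%:R * cond_relent t)).
Proof.
move=> Ct n0; pose tA x := \sum_y t (x, y).
have [b0|nC] := pickP C; last first.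
  by rewrite big_pred0 ?expR_ge0 // => b; rewrite nC.
move=> Cb0; have t0 w : 0 <= t w by rewrite -(Ct _ Cb0) emp_ge0.
have step b : C b -> \prod_i p (b i) =
    (\prod_i (t (a i, b i) / tA (a i))) * expR (- (n%:R * cond_relent t)).
  move=> Cb; have ti i : 0 < t (a i, b i).
    by rewrite -(Ct _ Cb); have := emp_gt0 (zipf a b) i; rewrite ffunE.
  have tAi i : 0 < tA (a i).
    by rewrite /tA (bigD1 (b i)) //= ltr_wpDr ?ti // sumr_ge0.
  have -> : n%:R * cond_relent t =
      \sum_i ln (t (a i, b i) / (tA (a i) * p (b i))).
    have := avg_emp (zipf a b) (fun w => ln (t w / (tA w.1 * p w.2))).
    rewrite (Ct _ Cb) /cond_relent => <-; rewrite /avg mulrC divfK ?pnatr_eq0 -?lt0n //.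
    by apply: eq_bigr => i _; rewrite ffunE.
  rewrite -sumrN expR_sum -big_split /=; apply: eq_bigr => i _.
  rewrite -lnV ?posrE ?divr_gt0 ?mulr_gt0 // lnK ?posrE ?invr_gt0 ?divr_gt0 ?mulr_gt0 //.
  by field; rewrite !gt_eqF.
rewrite (eq_bigr _ step) -mulr_suml ler_piMl ?expR_ge0 //.
apply: (@le_trans _ _ (\sum_(b : {ffun 'I_n -> B}) \prod_i (t (a i, b i) / tA (a i)))).
  rewrite [leRHS](bigID C) /= lerDl sumr_ge0 // => b _; rewrite prodr_ge0 // => i _.
  by rewrite divr_ge0 // sumr_ge0.
rewrite (sum_prod_ffun (fun i y => t (a i, y) / tA (a i))) prodr_ile1 // => i _.
rewrite sumr_ge0 /=; last by move=> y _; rewrite divr_ge0 // sumr_ge0.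
rewrite -mulr_suml -/(tA (a i)); have [->|ne] := eqVneq (tA (a i)) 0; first by rewrite mul0r.
by rewrite divff.
Qed.

(** A joint type is determined by counts in [{0, .., n}], one for each pair of letters, which bounds
    the number of types by the polynomial factor. *)
Lemma types_prob n (a : {ffun 'I_n -> A}) (E : pred {ffun 'I_n -> B}) (th : R) :
  (0 < n)%N -> (forall b, E b -> th <= cond_relent (emp (zipf a b))) ->
  \sum_(b : {ffun 'I_n -> B}) (\prod_i p (b i)) * (E b)%:R <= n.+1%:R ^+ #|{: A * B}| * expR (- (n%:R * th)).
Proof.
move=> n0 Eth.
pose cnt (b : {ffun 'I_n -> B}) : {ffun A * B -> 'I_n.+1} :=
  [ffun w => inord (\sum_i (zipf a b i == w))%N].
have cntP b b' : cnt b = cnt b' -> emp (zipf a b) = emp (zipf a b').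
  move=> /ffunP e; apply/funext => w; have := congr1 val (e w); rewrite !ffunE /= !inordK.
  - by rewrite /emp /avg => {}e; congr (_ / _); rewrite -!natr_sum e.
  - by rewrite ltnS -[leqRHS]card_ord -sum1_card; apply: leq_sum => i _; exact: leq_b1.
  - by rewrite ltnS -[leqRHS]card_ord -sum1_card; apply: leq_sum => i _; exact: leq_b1.
rewrite (partition_big cnt predT) //=.
have -> : n.+1%:R ^+ #|{: A * B}| * expR (- (n%:R * th)) =
    \sum_(k : {ffun A * B -> 'I_n.+1}) expR (- (n%:R * th)).
  by rewrite sumr_const card_ffun card_ord -[RHS]mulr_natl natrX.
apply: ler_sum => k _.
(* A type class that meets [E] is bounded as a whole, with the exponent read off one of its members
   in [E]. *)
have [b0 /andP[/eqP kb0 Eb0]|nE] := pickP (fun b => (cnt b == k) && E b); last first.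
  rewrite big1 ?expR_ge0 // => b kb; have := nE b; rewrite kb /= => ->; by rewrite mulr0.
apply: (@le_trans _ _ (\sum_(b | cnt b == k) \prod_i p (b i))).
  apply: ler_sum => b _; rewrite ler_piMr ?lern1 ?leq_b1 // prodr_ge0 // => i _; exact: ltW.
apply: le_trans (type_class_prob (a := a) (t := emp (zipf a b0)) _ n0) _.
  by move=> b /eqP kb; apply: cntP; rewrite kb.
by rewrite ler_expR lerN2 ler_wpM2l // Eth.
Qed.

(* Unlike the definition, this form is continuous in [t] up to the boundary of the simplex. *)
Lemma cond_relentE (t : A * B -> R) : is_pmf t -> cond_relent t =
  \sum_w t w * ln (t w) - \sum_w t w * ln (p w.2)
  - \sum_a (\sum_b t (a, b)) * ln (\sum_b t (a, b)).
Proof.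
move=> [t0 _].
have -> : \sum_a (\sum_b t (a, b)) * ln (\sum_b t (a, b)) =
    \sum_w t w * ln (\sum_b t (w.1, b)).
  under eq_bigr do rewrite mulr_suml.
  by rewrite pair_bigA; apply: eq_bigr => -[].
rewrite -!sumrB; apply: eq_bigr => w _.
have [->|tw] := eqVneq (t w) 0; first by rewrite !mul0r !subr0.
have tw0 : 0 < t w by rewrite lt0r tw t0.
have tA0 : 0 < \sum_b t (w.1, b).
  by rewrite (bigD1 w.2) //= -surjective_pairing ltr_wpDr ?tw0 // sumr_ge0.
rewrite ln_div ?posrE ?mulr_gt0 // lnM ?posrE //; ring.
Qed.

(** Exact linear constraints on the type are relaxed by compactness. The tolerance depends neither
    on [n] nor on the codeword [a], so the bound survives a union over an exponential codebook. *)
Lemma constrained_prob (I : finType) (phi : I -> A * B -> R) (c : I -> R) (th : R) :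
  (forall t, is_pmf t -> (forall k, \sum_w t w * phi k w = c k) -> th <= cond_relent t) ->
  forall d, 0 < d -> exists2 e, 0 < e & forall n (a : {ffun 'I_n -> A}), (0 < n)%N ->
  \sum_(b : {ffun 'I_n -> B}) (\prod_i p (b i)) *
    [forall k, `|avg (fun i => phi k (a i, b i)) - c k| <= e]%:R
  <= n.+1%:R ^+ #|{: A * B}| * expR (- (n%:R * (th - d))).
Proof.
move=> Hth d d0.
pose G (t : {ptws (A * B)%type -> R}) := \sum_k `|\sum_w t w * phi k w - c k|.
pose F (t : {ptws (A * B)%type -> R}) : R :=
  \sum_w t w * ln (t w) - \sum_w t w * ln (p w.2)
  - \sum_a (\sum_b t (a, b)) * ln (\sum_b t (a, b)).
have ev (x : A * B) : continuous (fun f : {ptws (A * B)%type -> R} => f x : R).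
  exact: (@proj_continuous (A * B)%type (fun=> R) x).
have evM (x : A * B) (r : R) : continuous (fun f : {ptws (A * B)%type -> R} => f x * r : R).
  by move=> f; apply: continuousM; [exact: ev | exact: cst_continuous].
have cF : continuous F.
  have xlnx (h : {ptws (A * B)%type -> R} -> R) : continuous h -> continuous (fun t => h t * ln (h t)).
    move=> ch t; apply: (@continuous_comp _ _ _ h (fun x : R => x * ln x)); first exact: ch.
    exact: continuous_xlnx.
  have c1 : continuous (fun t : {ptws (A * B)%type -> R} => \sum_w t w * ln (t w)).
    by apply: continuous_fsum => w; apply: (xlnx (fun t => t w)).
  have c2 : continuous (fun t : {ptws (A * B)%type -> R} => \sum_w t w * ln (p w.2)).
    by apply: continuous_fsum => w.
  have c3 : continuous (fun t : {ptws (A * B)%type -> R} =>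
      \sum_a (\sum_b t (a, b)) * ln (\sum_b t (a, b))).
    apply: continuous_fsum => a; apply: (xlnx (fun t => \sum_b t (a, b))).
    by apply: continuous_fsum => b.
  by move=> t; exact: (cvgB (cvgB (c1 t) (c2 t)) (c3 t)).
have cG : continuous G.
  apply: continuous_fsum => k.
  have ck : continuous (fun t : {ptws (A * B)%type -> R} => \sum_w t w * phi k w).
    by apply: continuous_fsum => w.
  by move=> t; exact: (cvg_norm (cvgB (ck t) (cvg_cst (c k)))).
have [e e0 He] : exists2 e, 0 < e &
    forall t, is_pmf (t : A * B -> R) -> G t <= e -> th - d <= F t.
  apply: (compact_slack (@compact_simplex R (A * B)%type) cF cG _ d0) => t tpmf Gt.
  rewrite -[F t]cond_relentE //; apply: Hth => // k.
  have Gk : G t = 0 by apply/le_anti; rewrite Gt sumr_ge0.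
  move/eqP: Gk; rewrite psumr_eq0 // => /allP /(_ k); rewrite mem_index_enum => /(_ isT) /=.
  by rewrite normr_eq0 subr_eq0 => /eqP.
(* The [#|I|] violations, each within this tolerance, add up to at most [e]; the successor covers an
   empty [I]. *)
exists (e / #|I|.+1%:R); first by rewrite divr_gt0.
move=> n a n0; apply: (types_prob (a := a)) => // b /forallP Hb.
have epmf := emp_pmf (zipf a b) n0.
rewrite cond_relentE // -/(F (emp (zipf a b))). apply: He => //.
apply: (@le_trans _ _ (\sum_(k : I) e / #|I|.+1%:R)).
  apply: ler_sum => k _; rewrite -avg_emp.
  by have := Hb k; rewrite /avg; under [in X in _ -> X]eq_bigr do rewrite ffunE.
rewrite sumr_const -mulrnAr -[leRHS]mulr1 ler_pM2l //.
by rewrite -mulr_natr mulrC ler_pdivrMr // mul1r ler_nat.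
Qed.

End Types.

(** * Limits and asymptotics *)

Section Limits.
Variable R : realType.

Lemma limn_esup_le_eps (u : nat -> \bar R) (l : R) :
  (forall d, 0 < d -> \forall n \near \oo%classic, (u n <= (l + d)%:E)%E) ->
  (limn_esup u <= l%:E)%E.
Proof.
move=> H; apply/lee_addgt0Pr => d d0; rewrite limn_esup_lim -EFinD.
apply: lime_le; first exact: is_cvg_esups.
have [N _ HN] := H d d0; exists N => // n /= Nn.
by apply: ub_ereal_sup => _ [k /= nk <-]; apply: HN => /=; exact: leq_trans nk.
Qed.

Lemma limn_einf_ge_eps (u : nat -> \bar R) (l : R) :
  (forall d, 0 < d -> \forall n \near \oo%classic, ((l - d)%:E <= u n)%E) ->
  (l%:E <= limn_einf u)%E.
Proof.
move=> H; rewrite /limn_einf leeNr -EFinN; apply: limn_esup_le_eps => d /H.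
by apply: filterS => n; rewrite leeNl -EFinN opprD opprK.
Qed.

(** At blocklength [n], take an element good for the finest slack among [1 / (k + 1)], [k <= n],
    that admits one. By monotonicity it is good for all coarser ones, and every fixed slack is
    eventually among those that admit one. *)
Lemma diagonal_choice (T : nat -> Type) (dflt : forall n, T n)
    (good : R -> forall n, T n -> Prop) :
  (forall d d' n c, d <= d' -> good d n c -> good d' n c) ->
  (forall d, 0 < d -> \forall n \near \oo%classic, exists c : T n, good d n c) ->
  exists c : forall n, T n, forall d, 0 < d -> \forall n \near \oo%classic, good d n (c n).
Proof.
move=> mono H; pose rate (k : nat) : R := k.+1%:R^-1.
have best n m : exists c : T n, forall k, (k <= m)%N ->
    (exists c', good (rate k) n c') -> good (rate k) n c.
  elim: m => [|m [c IH]].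
    have [[c gc]|nc] := pselect (exists c, good (rate 0) n c).
      by exists c => k; rewrite leqn0 => /eqP ->.
    by exists (dflt n) => k; rewrite leqn0 => /eqP ->.
  have [[c' gc']|nc] := pselect (exists c', good (rate m.+1) n c').
    exists c' => k km _; apply: mono gc'.
    by rewrite /rate lef_pV2 ?posrE ?ltr0n // ler_nat.
  by exists c => k; rewrite leq_eqVlt => /predU1P[->//|]; exact: IH.
exists (fun n => sval (cid (best n n))) => d d0.
have [k kd] : exists k, rate k <= d.
  exists (Num.truncn d^-1); rewrite /rate -[leRHS]invrK lef_pV2 ?posrE ?invr_gt0 ?ltr0n //.
  by rewrite ltW // truncnS_gt.
near=> n; apply: mono kd _; case: cid => c /= cP; apply: cP.
  by near: n; exact: nbhs_infty_ge.
near: n; apply: H; by rewrite invr_gt0 ltr0n.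
Unshelve. all: by end_near. Qed.

(** The termwise bound comes from [ln r <= r - 1] at [r = q w / p w]. *)
Lemma gibbs (W : finType) (p q : W -> R) :
  is_pmf p -> (forall w, 0 <= q w) -> \sum_w q w <= 1 -> (forall w, q w = 0 -> p w = 0) ->
  0 <= \sum_w p w * ln (p w / q w).
Proof.
move=> [p0 p1] q0 q1 ac; apply: (@le_trans _ _ (\sum_w (p w - q w))).
  by rewrite sumrB p1 subr_ge0.
apply: ler_sum => w _; have [->|pw] := eqVneq (p w) 0; first by rewrite mul0r sub0r oppr_le0.
have pw0 : 0 < p w by rewrite lt0r pw p0.
have qw0 : 0 < q w by rewrite lt0r q0 andbT; apply: contra_neq pw => /ac.
have := @le_ln1Dx R (q w / p w - 1); rewrite [1 + _]addrC subrK ltrBrDr addNr.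
have r0 : 0 < q w / p w by rewrite divr_gt0.
move=> /(_ r0) H; rewrite -[p w / q w]invf_div lnV ?posrE // mulrN lerNr opprB.
by apply: le_trans (ler_wpM2l (p0 w) H) _; rewrite mulrBr mulrC divfK // mulr1.
Qed.

Lemma near_linear_ge (a d : R) : 0 < d -> \forall n \near \oo%classic, a <= n%:R * d.
Proof.
by move=> d0; near=> n; rewrite -ler_pdivrMr //; near: n; exact: nbhs_infty_ger.
Unshelve. all: by end_near. Qed.

Lemma near_poly_le_exp (c : nat) (d : R) : 0 < d ->
  \forall n \near \oo%classic, n.+1%:R ^+ c <= expR (n%:R * d).
Proof.
move=> d0; pose b : R := Num.min 1 (d / (2 * c.+1%:R)).
have b0 : 0 < b by rewrite lt_min ltr01 divr_gt0.
have b1 : b <= 1 by rewrite ge_min lexx.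
have cb : c%:R * b <= d / 2.
  apply: (@le_trans _ _ (c.+1%:R * b)); first by rewrite ler_wpM2r ?(ltW b0) // ler_nat.
  rewrite mulrC -ler_pdivlMr ?ltr0n // ge_min; apply/orP; right.
  by rewrite invfM mulrA.
near=> n.
have nb : n.+1%:R <= b^-1 * expR (n%:R * b).
  rewrite ler_pdivlMl //; apply: le_trans (expR_ge1Dx _).
  by rewrite -natr1 mulrDr mulr1 addrC mulrC lerD2r.
apply: (@le_trans _ _ ((b^-1 * expR (n%:R * b)) ^+ c)).
  by apply: lerXn2r => //; rewrite nnegrE // mulr_ge0 ?expR_ge0 ?invr_ge0 ?(ltW b0).
rewrite exprMn -expRM_natl mulrCA -[b^-1 ^+ c]lnK; last by rewrite posrE exprn_gt0 // invr_gt0.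
rewrite -expRD ler_expR.
have -> : n%:R * d = n%:R * (d / 2) + n%:R * (d / 2) by lra.
apply: lerD; last by rewrite ler_wpM2l.
by near: n; apply: near_linear_ge; rewrite divr_gt0.
Unshelve. all: by end_near. Qed.

Definition nwords (n : nat) (r : R) : nat := (Num.truncn (expR (n%:R * r))).+1.

(** The successor makes room for the failure message. Rounding and this message add at most 2,
    absorbed once [expR (n * d)] reaches 3. *)
Lemma nwords_le (r d : R) : 0 <= r -> 0 < d ->
  \forall n \near \oo%classic, (nwords n r).+1%:R <= expR (n%:R * (r + d)).
Proof.
move=> r0 d0; near=> n.
have e1 : 1 <= expR (n%:R * r) by rewrite -expR0 ler_expR mulr_ge0.
have /andP[trn _] := truncn_itv (expR_ge0 (n%:R * r)).
have d3 : 3 <= expR (n%:R * d).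
  apply: le_trans (expR_ge1Dx _); rewrite (_ : 3 = 1 + 2); last by lra.
  by rewrite lerD2l; near: n; exact: near_linear_ge.
rewrite mulrDr expRD mulrC /nwords -!natr1.
by have := expR_ge0 (n%:R * r); nra.
Unshelve. all: by end_near. Qed.

(** There are [expR (n * d)] times more codewords than the sampling constant [expR (n * r)], so all
    of them are rejected with doubly exponentially small probability. *)
Lemma nwords_covers (r d k : R) : 0 < d -> 0 < k ->
  \forall n \near \oo%classic, expR (- ((nwords n (r + d))%:R / (2 * expR (n%:R * r)))) <= k.
Proof.
move=> d0 k0; near=> n.
rewrite -[leRHS]lnK ?posrE // ler_expR lerNl ler_pdivlMr ?mulr_gt0 ?expR_gt0 //.
have : - ln k * 2 <= n%:R * d by near: n; exact: near_linear_ge.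
have : expR (n%:R * r) * expR (n%:R * d) <= (nwords n (r + d))%:R.
  by rewrite -expRD -mulrDr ltW // truncnS_gt.
have := expR_ge1Dx (n%:R * d).
have := expR_ge0 (n%:R * r).
by nra.
Unshelve. all: by end_near. Qed.

End Limits.

(** * Single-letter quantities *)

Section Marginals.
Variable R : realType.

Definition marg (W S : finType) (pi : W -> S) (t : W -> R) (s : S) : R :=
  \sum_w t w * (pi w == s)%:R.

Lemma marg_mean (W S : finType) (pi : W -> S) (t : W -> R) (f : S -> R) :
  \sum_w t w * f (pi w) = \sum_s marg pi t s * f s.
Proof.
under [RHS]eq_bigr do rewrite mulr_suml; rewrite exchange_big /=; apply: eq_bigr => w _.
rewrite (bigD1 (pi w)) //= eqxx mulr1 big1 ?addr0 // => s ne.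
by rewrite eq_sym (negbTE ne) mulr0 mul0r.
Qed.

(** This passes from the indicator form of a marginal to a sum over the remaining coordinates [rho],
    with [h] reassembling the point. *)
Lemma marg_fiber (W S T : finType) (pi : W -> S) (rho : W -> T) (h : S * T -> W) (t : W -> R) :
  cancel h (fun w => (pi w, rho w)) -> cancel (fun w => (pi w, rho w)) h ->
  forall s, marg pi t s = \sum_r t (h (s, r)).
Proof.
move=> hK Kh s; rewrite /marg (reindex h) /=; last by exists (fun w => (pi w, rho w)) => w _.
have piK sr : pi (h sr) = sr.1 by have := congr1 fst (hK sr).
under eq_bigr do rewrite piK.
transitivity (\sum_s' \sum_r t (h (s', r)) * (s' == s)%:R).
  by rewrite pair_bigA; apply: eq_bigr => -[s1 r1] _.
rewrite (bigD1 s) //= eqxx [X in _ + X]big1 ?addr0 => [|s' ne].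
  by apply: eq_bigr => r _; rewrite mulr1.
apply: big1 => r _; by rewrite (negbTE ne) mulr0.
Qed.

End Marginals.

Section SingleLetter.
Variables (R : realType) (X Y1 Y2 U V : finType).
Variable Q : U -> V -> X -> Y1 -> Y2 -> R.
Variables (P : X -> Y1 -> Y2 -> R) (R1 R2 : R).
Hypothesis HQ : in_S Q P R1 R2.

Definition letter : finType := (X * Y1 * Y2 * U * V)%type.

Definition lx (w : letter) : X := w.1.1.1.1.
Definition ly1 (w : letter) : Y1 := w.1.1.1.2.
Definition ly2 (w : letter) : Y2 := w.1.1.2.
Definition lu (w : letter) : U := w.1.2.
Definition lv (w : letter) : V := w.2.

Definition Qw (w : letter) : R := Q (lu w) (lv w) (lx w) (ly1 w) (ly2 w).

Lemma Q_ge0 u v x y1 y2 : 0 <= Q u v x y1 y2.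
Proof. by have [[q0 _] _] := HQ; exact: (q0 (u, v, x, y1, y2)). Qed.

Lemma Qw_pmf : is_pmf Qw.
Proof.
have [[q0 q1] _] := HQ; split=> [w|]; first exact: Q_ge0.
rewrite -q1 (reindex (fun w : U * V * X * Y1 * Y2 =>
  (w.1.1.2, w.1.2, w.2, w.1.1.1.1, w.1.1.1.2) : letter)) //=.
by exists (fun w => (lu w, lv w, lx w, ly1 w, ly2 w)) => [[[[[? ?] ?] ?] ?] _|[[[[? ?] ?] ?] ?] _].
Qed.

Lemma marg_QUX u x : marg (fun w => (lu w, lx w)) Qw (u, x) = QUX Q u x.
Proof.
rewrite (@marg_fiber _ _ _ (V * Y1 * Y2)%type _ (fun w => (lv w, ly1 w, ly2 w))
  (fun sr => (sr.1.2, sr.2.1.2, sr.2.2, sr.1.1, sr.2.1.1))); [|by move=> [[? ?] [[? ?] ?]]|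
  by move=> [[[[? ?] ?] ?] ?]].
by rewrite /QUX !pair_bigA /=; apply: eq_bigr => -[[? ?] ?] _.
Qed.

Lemma marg_QUY1 u y1 : marg (fun w => (lu w, ly1 w)) Qw (u, y1) = QUY1 Q u y1.
Proof.
rewrite (@marg_fiber _ _ _ (V * X * Y2)%type _ (fun w => (lv w, lx w, ly2 w))
  (fun sr => (sr.2.1.2, sr.1.2, sr.2.2, sr.1.1, sr.2.1.1))); [|by move=> [[? ?] [[? ?] ?]]|
  by move=> [[[[? ?] ?] ?] ?]].
by rewrite /QUY1 !pair_bigA /=; apply: eq_bigr => -[[? ?] ?] _.
Qed.

Lemma marg_QUVY1 u v y1 : marg (fun w => (lu w, lv w, ly1 w)) Qw (u, v, y1) = QUVY1 Q u v y1.
Proof.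
rewrite (@marg_fiber _ _ _ (X * Y2)%type _ (fun w => (lx w, ly2 w))
  (fun sr => (sr.2.1, sr.1.2, sr.2.2, sr.1.1.1, sr.1.1.2))); [|by move=> [[[? ?] ?] [? ?]]|
  by move=> [[[[? ?] ?] ?] ?]].
by rewrite /QUVY1 !pair_bigA /=; apply: eq_bigr => -[? ?] _.
Qed.

Lemma marg_QUVY2 u v y2 : marg (fun w => (lu w, lv w, ly2 w)) Qw (u, v, y2) = QUVY2 Q u v y2.
Proof.
rewrite (@marg_fiber _ _ _ (X * Y1)%type _ (fun w => (lx w, ly1 w))
  (fun sr => (sr.2.1, sr.2.2, sr.1.2, sr.1.1.1, sr.1.1.2))); [|by move=> [[[? ?] ?] [? ?]]|
  by move=> [[[[? ?] ?] ?] ?]].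
by rewrite /QUVY2 !pair_bigA /=; apply: eq_bigr => -[? ?] _.
Qed.

Definition QU u : R := \sum_x QUX Q u x.
Definition QUV u v : R := \sum_y1 QUVY1 Q u v y1.

Lemma sum_QUV u : \sum_v QUV u v = QU u.
Proof.
rewrite /QUV /QU /QUVY1 /QUX; under eq_bigr do rewrite exchange_big /=.
by rewrite exchange_big.
Qed.

Lemma sum_QUY1 u : \sum_y1 QUY1 Q u y1 = QU u.
Proof. by rewrite -sum_QUV /QUY1 exchange_big. Qed.

Lemma sum_QU : \sum_u QU u = 1.
Proof.
have [_ <-] := Qw_pmf; have := marg_mean (fun w => (lu w, lx w)) Qw (fun=> 1).
under eq_bigr do rewrite mulr1; move=> ->; rewrite pair_bigA.
by apply: eq_bigr => -[u x] _; rewrite mulr1 marg_QUX.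
Qed.

Let sum_ge0 (T : finType) (F : T -> R) : (forall t, 0 <= F t) -> 0 <= \sum_t F t.
Proof. by move=> F0; apply: sumr_ge0. Qed.

Lemma QUX_ge0 u x : 0 <= QUX Q u x.
Proof. by do 3![apply: sum_ge0 => ?]; exact: Q_ge0. Qed.
Lemma QX_ge0 x : 0 <= QX Q x.
Proof. by apply: sum_ge0 => u; exact: QUX_ge0. Qed.
Lemma QU_ge0 u : 0 <= QU u.
Proof. by apply: sum_ge0 => x; exact: QUX_ge0. Qed.
Lemma QUVY1_ge0 u v y1 : 0 <= QUVY1 Q u v y1.
Proof. by do 2![apply: sum_ge0 => ?]; exact: Q_ge0. Qed.
Lemma QUY1_ge0 u y1 : 0 <= QUY1 Q u y1.
Proof. by apply: sum_ge0 => v; exact: QUVY1_ge0. Qed.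
Lemma QUV_ge0 u v : 0 <= QUV u v.
Proof. by apply: sum_ge0 => y1; exact: QUVY1_ge0. Qed.

Let le_sum (T : finType) (F : T -> R) t : (forall t, 0 <= F t) -> F t <= \sum_t F t.
Proof. by move=> F0; rewrite (bigD1 t) //= lerDl sumr_ge0. Qed.

Lemma QUX_le_QX u x : QUX Q u x <= QX Q x.
Proof. by apply: (@le_sum _ (fun u => QUX Q u x)) => ?; exact: QUX_ge0. Qed.
Lemma QUX_le_QU u x : QUX Q u x <= QU u.
Proof. by apply: (@le_sum _ (fun x => QUX Q u x)) => ?; exact: QUX_ge0. Qed.
Lemma QUVY1_le_QUV u v y1 : QUVY1 Q u v y1 <= QUV u v.
Proof. by apply: (@le_sum _ (fun y1 => QUVY1 Q u v y1)) => ?; exact: QUVY1_ge0. Qed.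
Lemma QUVY1_le_QUY1 u v y1 : QUVY1 Q u v y1 <= QUY1 Q u y1.
Proof. by apply: (@le_sum _ (fun v => QUVY1 Q u v y1)) => ?; exact: QUVY1_ge0. Qed.
Lemma QUV_le_QU u v : QUV u v <= QU u.
Proof. by rewrite -sum_QUV; apply: (@le_sum _ (fun v => QUV u v)) => ?; exact: QUV_ge0. Qed.

Lemma Q_le_QUX u v x y1 y2 : Q u v x y1 y2 <= QUX Q u x.
Proof.
apply: le_trans (@le_sum _ (fun v => \sum_y1 \sum_y2 Q u v x y1 y2) v _); last first.
  by move=> ?; do 2![apply: sum_ge0 => ?]; exact: Q_ge0.
apply: le_trans (@le_sum _ (fun y1 => \sum_y2 Q u v x y1 y2) y1 _); last first.
  by move=> ?; apply: sum_ge0 => ?; exact: Q_ge0.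
by apply: (@le_sum _ (fun y2 => Q u v x y1 y2)) => ?; exact: Q_ge0.
Qed.

Lemma Q_le_QUVY1 u v x y1 y2 : Q u v x y1 y2 <= QUVY1 Q u v y1.
Proof.
apply: le_trans (@le_sum _ (fun x => \sum_y2 Q u v x y1 y2) x _); last first.
  by move=> ?; apply: sum_ge0 => ?; exact: Q_ge0.
by apply: (@le_sum _ (fun y2 => Q u v x y1 y2)) => ?; exact: Q_ge0.
Qed.

Lemma P_le_QX x y1 y2 : P x y1 y2 <= QX Q x.
Proof.
have [_ [<- _]] := HQ; apply: ler_sum => u _; apply: ler_sum => v _.
apply: le_trans (@le_sum _ (fun y1 => \sum_y2 Q u v x y1 y2) y1 _); last first.
  by move=> ?; apply: sum_ge0 => ?; exact: Q_ge0.
by apply: (@le_sum _ (fun y2 => Q u v x y1 y2)) => ?; exact: Q_ge0.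
Qed.

Lemma P_ge0 x y1 y2 : 0 <= P x y1 y2.
Proof.
have [_ [<- _]] := HQ.
by do 2![apply: sum_ge0 => ?]; exact: Q_ge0.
Qed.

Lemma sum_PU_X x : \sum_u PU_X Q u x = QX Q x / QX Q x.
Proof. by rewrite /PU_X -mulr_suml. Qed.

Lemma sum_PV_Y1U y1 u : \sum_v PV_Y1U Q v y1 u = QUY1 Q u y1 / QUY1 Q u y1.
Proof. by rewrite /PV_Y1U -mulr_suml. Qed.

Let self_div_le1 (x : R) : x / x <= 1.
Proof. by have [->|n] := eqVneq x 0; rewrite ?mul0r ?divff. Qed.

Lemma sum_PU_X_le1 x : \sum_u PU_X Q u x <= 1.
Proof. by rewrite sum_PU_X. Qed.
Lemma sum_PV_Y1U_le1 y1 u : \sum_v PV_Y1U Q v y1 u <= 1.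
Proof. by rewrite sum_PV_Y1U. Qed.

Lemma PU_X_ge0 u x : 0 <= PU_X Q u x.
Proof. by rewrite divr_ge0 ?QUX_ge0 ?QX_ge0. Qed.
Lemma PV_Y1U_ge0 v y1 u : 0 <= PV_Y1U Q v y1 u.
Proof. by rewrite divr_ge0 ?QUVY1_ge0 ?QUY1_ge0. Qed.

(** Where [QX] vanishes the conditional pmf sums to 0 rather than 1, but [P] vanishes there too. *)
Lemma P_sum_PU_X x y1 y2 : P x y1 y2 * (\sum_u PU_X Q u x) = P x y1 y2.
Proof.
rewrite sum_PU_X; have [e|n] := eqVneq (QX Q x) 0; last by rewrite divff // mulr1.
rewrite e mul0r mulr0; apply/esym/le_anti.
by rewrite P_ge0 (le_trans (P_le_QX _ _ _)) ?e.
Qed.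

Lemma P_PU_X x y1 y2 u : P x y1 y2 * PU_X Q u x = \sum_v Q u v x y1 y2.
Proof.
have [_ [QP [mk _]]] := HQ; have := mk u x (y1, y2) => /=.
have -> : \sum_a \sum_(c : Y1 * Y2) \sum_v Q a v x c.1 c.2 = QX Q x.
  apply: eq_bigr => a _; rewrite exchange_big /=; apply: eq_bigr => v _.
  by rewrite pair_bigA.
have -> : \sum_(c : Y1 * Y2) \sum_v Q u v x c.1 c.2 = QUX Q u x.
  by rewrite exchange_big /=; apply: eq_bigr => v _; rewrite pair_bigA.
rewrite QP => e; have [x0|nx] := eqVneq (QX Q x) 0.
  have P0 : P x y1 y2 = 0 by apply/le_anti; rewrite P_ge0 -x0 P_le_QX.
  rewrite P0 mul0r; apply/le_anti/andP; split; first by apply: sum_ge0 => v; exact: Q_ge0.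
  apply: (@le_trans _ _ (P x y1 y2)); last by rewrite P0.
  rewrite -QP; apply: (@le_sum _ (fun u => \sum_v Q u v x y1 y2) u) => ?.
  by apply: sum_ge0 => ?; exact: Q_ge0.
by rewrite /PU_X mulrA [P _ _ _ * _]mulrC -e mulfK.
Qed.

(** The two Markov chains together: passing the source through both test channels reproduces [Q].
    This is why the simulated codewords have the law of [Q] under the null hypothesis. *)
Lemma P_PU_X_PV_Y1U x y1 y2 u v :
  P x y1 y2 * PU_X Q u x * PV_Y1U Q v y1 u = Q u v x y1 y2.
Proof.
rewrite P_PU_X; have [_ [_ [_ [mk _]]]] := HQ; have := mk v (y1, u) (y2, x) => /=.
have E v' : \sum_(c : Y2 * X) Q u v' c.2 y1 c.1 = QUVY1 Q u v' y1.
  by rewrite /QUVY1 exchange_big pair_bigA.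
under eq_bigr do rewrite E; rewrite E -/(QUY1 Q u y1) => e.
have [y0|ny] := eqVneq (QUY1 Q u y1) 0.
  rewrite /PV_Y1U y0 invr0 !mulr0; apply/le_anti; rewrite Q_ge0.
  by rewrite -y0 (le_trans (Q_le_QUVY1 _ _ _ _ _)) // QUVY1_le_QUY1.
by rewrite /PV_Y1U mulrA [X in X / _]mulrC -e mulfK.
Qed.

Lemma P_PU_X_sum_PV_Y1U x y1 y2 u :
  P x y1 y2 * PU_X Q u x * (\sum_v PV_Y1U Q v y1 u) = P x y1 y2 * PU_X Q u x.
Proof.
by rewrite [RHS]P_PU_X mulr_sumr; apply: eq_bigr => v _; exact: P_PU_X_PV_Y1U.
Qed.


(** Information densities: their means under [Q] are [I(U;X)] and [I(V;Y1|U)]. *)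
Definition idens1 u x : R := ln (QUX Q u x / (QU u * QX Q x)).
Definition idens2 u v y1 : R := ln (QUVY1 Q u v y1 * QU u / (QUV u v * QUY1 Q u y1)).

Lemma mutinf_mean : mutinf (QUX Q) = \sum_s marg (fun w => (lu w, lx w)) Qw s * idens1 s.1 s.2.
Proof. by rewrite /mutinf pair_bigA; apply: eq_bigr => -[u x] _; rewrite marg_QUX. Qed.

Lemma condmutinf_mean : condmutinf (fun v y1 u => QUVY1 Q u v y1) =
  \sum_s marg (fun w => (lu w, lv w, ly1 w)) Qw s * idens2 s.1.1 s.1.2 s.2.
Proof.
transitivity (\sum_v \sum_y1 \sum_u QUVY1 Q u v y1 * idens2 u v y1).
  by do 3![apply: eq_bigr => ? _]; rewrite /idens2 -sum_QUV.
rewrite !pair_bigA (reindex (fun s : U * V * Y1 => (s.1.2, s.2, s.1.1))) /=.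
  by apply: eq_bigr => -[[u v] y1] _; rewrite marg_QUVY1.
by exists (fun s => (s.2, s.1.1, s.1.2)) => [[[? ?] ?] _|[[? ?] ?] _].
Qed.

(** Nonnegativity makes the codebook rates admissible in [nwords_le]. *)
Lemma mutinf_ge0 : 0 <= mutinf (QUX Q).
Proof.
rewrite mutinf_mean (eq_bigr (fun s => QUX Q s.1 s.2 * idens1 s.1 s.2)); last first.
  by move=> [u x] _; rewrite marg_QUX.
apply: gibbs => [|s||s].
- split=> [s|]; first exact: QUX_ge0.
  by rewrite -sum_QU /QU [RHS]pair_bigA.
- by rewrite mulr_ge0 ?QU_ge0 ?QX_ge0.
- rewrite -(pair_bigA _ (fun u x => QU u * QX Q x)) /=.
  under eq_bigr do rewrite -mulr_sumr.
  rewrite -mulr_suml sum_QU mul1r -sum_QU /QU [leRHS]exchange_big /=.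
  by apply: ler_sum.
- move/eqP; rewrite mulf_eq0 => /orP[] /eqP e; apply/le_anti; rewrite QUX_ge0 andbT -e.
    exact: QUX_le_QU.
  exact: QUX_le_QX.
Qed.

Lemma condmutinf_ge0 : 0 <= condmutinf (fun v y1 u => QUVY1 Q u v y1).
Proof.
rewrite condmutinf_mean (eq_bigr (fun s => QUVY1 Q s.1.1 s.1.2 s.2 *
  ln (QUVY1 Q s.1.1 s.1.2 s.2 / (QUV s.1.1 s.1.2 * QUY1 Q s.1.1 s.2 / QU s.1.1)))); last first.
  by move=> [[u v] y1] _; rewrite marg_QUVY1 /idens2 /= invf_div mulrA.
apply: gibbs => [|s||s].
- split=> [s|]; first exact: QUVY1_ge0.
  rewrite -sum_QU; under [RHS]eq_bigr do rewrite -sum_QUV.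
  by rewrite /QUV 2![RHS]pair_bigA.
- by rewrite divr_ge0 ?mulr_ge0 ?QUV_ge0 ?QUY1_ge0 ?QU_ge0.
- rewrite -sum_QU.
  have -> : \sum_(s : U * V * Y1) QUV s.1.1 s.1.2 * QUY1 Q s.1.1 s.2 / QU s.1.1 =
      \sum_u \sum_v \sum_y1 QUV u v * QUY1 Q u y1 / QU u by rewrite !pair_bigA.
  apply: ler_sum => u _; under eq_bigr do rewrite -mulr_suml -mulr_sumr sum_QUY1.
  rewrite -!mulr_suml sum_QUV -mulrA ler_piMr ?QU_ge0 //.
- move/eqP; rewrite !mulf_eq0 invr_eq0 -orbA => /or3P[] /eqP e; apply/le_anti;
    rewrite QUVY1_ge0 andbT -e.
  + exact: QUVY1_le_QUV.
  + exact: QUVY1_le_QUY1.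
  + exact: le_trans (QUVY1_le_QUV _ _ _) (QUV_le_QU _ _).
Qed.

(** * Exponents of the joint types: divergence plus codebook rates *)

Variable Pbar : X -> Y1 -> Y2 -> R.
Hypothesis Pbar_gt0 : forall x y1 y2, 0 < Pbar x y1 y2.

Definition alt_XY1 (b : X * Y1) : R := \sum_y2 Pbar b.1 b.2 y2.
Definition alt_XY1Y2 (b : X * Y1 * Y2) : R := Pbar b.1.1 b.1.2 b.2.

(** The marginal constraints of [in_L1] written as finitely many linear constraints on the type,
    with values [target1], as required by [constrained_prob]. *)
Definition test1 (k : (U * X) + (U * Y1)) (w : U * (X * Y1)) : R :=
  match k with
  | inl s => ((w.1, w.2.1) == s)%:R
  | inr s => ((w.1, w.2.2) == s)%:R
  end.
Definition target1 (k : (U * X) + (U * Y1)) : R :=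
  match k with inl s => QUX Q s.1 s.2 | inr s => QUY1 Q s.1 s.2 end.

Definition test2 (k : (U * X) + ((U * V * Y1) + (U * V * Y2)))
    (w : (U * V) * (X * Y1 * Y2)) : R :=
  match k with
  | inl s => ((w.1.1, w.2.1.1) == s)%:R
  | inr (inl s) => ((w.1, w.2.1.2) == s)%:R
  | inr (inr s) => ((w.1, w.2.2) == s)%:R
  end.
Definition target2 (k : (U * X) + ((U * V * Y1) + (U * V * Y2))) : R :=
  match k with
  | inl s => QUX Q s.1 s.2
  | inr (inl s) => QUVY1 Q s.1.1 s.1.2 s.2
  | inr (inr s) => QUVY2 Q s.1.1 s.1.2 s.2
  end.

(** Since [t] has [U]-marginal [QU], its density against [t_U Pbar] is its density against [Qbar]
    times that of [QUX] against [QU * QX]. The logarithm of the latter factor is [idens1], whose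
    mean depends only on the [(U, X)]-marginal and hence equals [I(U;X)]. *)
Lemma exponent1 (th : R) : (forall b, 0 < alt_XY1 b) ->
  (forall t, in_L1 Q t -> (th%:E <= div1 Q Pbar t)%E) ->
  forall t, is_pmf t -> (forall k, \sum_w t w * test1 k w = target1 k) ->
  th + mutinf (QUX Q) <= cond_relent alt_XY1 t.
Proof.
move=> Pb0 Hth t tpmf Ht; have [t0 t1] := tpmf.
have mX s : marg (fun w : U * (X * Y1) => (w.1, w.2.1)) t s = QUX Q s.1 s.2 := Ht (inl s).
have mY s : marg (fun w : U * (X * Y1) => (w.1, w.2.2)) t s = QUY1 Q s.1 s.2 := Ht (inr s).
have tX u x : \sum_y1 t (u, (x, y1)) = QUX Q u x.
  rewrite -(mX (u, x)) (@marg_fiber _ _ _ Y1 _ (fun w => w.2.2)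
    (fun sr => (sr.1.1, (sr.1.2, sr.2)))) //; first by move=> [[? ?] ?].
  by move=> [? [? ?]].
have tY u y1 : \sum_x t (u, (x, y1)) = QUY1 Q u y1.
  rewrite -(mY (u, y1)) (@marg_fiber _ _ _ X _ (fun w => w.2.1)
    (fun sr => (sr.1.1, (sr.2, sr.1.2)))) //; first by move=> [[? ?] ?].
  by move=> [? [? ?]].
have L1 : in_L1 Q (fun u x y1 => t (u, (x, y1))).
  split=> //; split=> [w|]; first exact: t0.
  rewrite -t1 (reindex (fun w : U * X * Y1 => (w.1.1, (w.1.2, w.2)))) //=.
  by exists (fun w => (w.1, w.2.1, w.2.2)) => [[[? ?] ?] _|[? [? ?]] _].
have qE u x y1 : 0 < t (u, (x, y1)) ->
    \sum_v \sum_y2 Qbar Q Pbar u v x y1 y2 = alt_XY1 (x, y1) * PU_X Q u x /\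
    [/\ 0 < QUX Q u x, 0 < QX Q x & 0 < QU u].
  move=> tp; have QUX0 : 0 < QUX Q u x.
    by apply: lt_le_trans tp _; rewrite -tX; apply: (@le_sum _ (fun y1 => t (u, (x, y1)))).
  have QUY0 : 0 < QUY1 Q u y1.
    by apply: lt_le_trans tp _; rewrite -tY; apply: (@le_sum _ (fun x => t (u, (x, y1)))).
  split; last by split=> //; [exact: lt_le_trans QUX0 (QUX_le_QX _ _) | exact: lt_le_trans QUX0 (QUX_le_QU _ _)].
  rewrite /Qbar; under eq_bigr do rewrite -!mulr_suml.
  by rewrite -mulr_sumr sum_PV_Y1U divff ?mulr1 // gt_eqF.
(* The infinite branch of [KLdiv] is impossible: where [t] is positive, so are the marginals of [Q]
   it matches, and with them the alternative law. *)
have := Hth _ L1; rewrite /div1 /KLdiv /=; case: ifP => [/existsP[[[u x] y1] /= /andP[tp /eqP]]|_].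
  have [-> [a b _]] := qE _ _ _ tp.
  by move/eqP; rewrite gt_eqF // mulr_gt0 ?divr_gt0.
rewrite lee_fin (reindex (fun w : U * (X * Y1) => (w.1, w.2.1, w.2.2))) /=; last first.
  by exists (fun w => (w.1.1, (w.1.2, w.2))) => [[? [? ?]] _|[[? ?] ?] _].
move=> H; have -> : cond_relent alt_XY1 t =
    \sum_w t w * ln (t w / \sum_v \sum_y2 Qbar Q Pbar w.1 v w.2.1 w.2.2 y2)
    + \sum_w t w * idens1 w.1 w.2.1.
  rewrite -big_split /=; apply: eq_bigr => -[u [x y1]] _ /=.
  have [->|tw] := eqVneq (t (u, (x, y1))) 0; first by rewrite !mul0r addr0.
  have tp : 0 < t (u, (x, y1)) by rewrite lt0r tw t0.
  have [-> [a b c]] := qE _ _ _ tp.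
  have -> : \sum_b t (u, b) = QU u.
    rewrite /QU; under [RHS]eq_bigr do rewrite -tX.
    by rewrite pair_bigA; apply: eq_bigr => -[? ?] _.
  have Pb := Pb0 (x, y1).
  rewrite -mulrDr /idens1 /PU_X -lnM ?posrE ?mulr_gt0 ?invr_gt0 ?mulr_gt0 ?invr_gt0 ?mulr_gt0 ?invr_gt0 ?mulr_gt0 //.
  by congr (_ * ln _); field; rewrite !gt_eqF.
have -> : \sum_w t w * idens1 w.1 w.2.1 = \sum_s QUX Q s.1 s.2 * idens1 s.1 s.2.
  have := marg_mean (fun w : U * (X * Y1) => (w.1, w.2.1)) t (fun s => idens1 s.1 s.2).
  by move=> /= ->; apply: eq_bigr => s _; rewrite mX.
rewrite mutinf_mean; apply: lerD.
  by apply: le_trans H _; rewrite le_eqVlt; apply/orP; left; apply/eqP; apply: eq_bigr => -[? [? ?]] _.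
by apply: ler_sum => -[u x] _; rewrite marg_QUX.
Qed.

(** As for [exponent1], with the extra factor [idens2], whose mean is fixed by the
    [(U, V, Y1)]-marginal. *)
Lemma exponent2 (th : R) :
  (forall t, in_L2 Q t -> (th%:E <= div2 Q Pbar t)%E) ->
  forall t, is_pmf t -> (forall k, \sum_w t w * test2 k w = target2 k) ->
  th + mutinf (QUX Q) + condmutinf (fun v y1 u => QUVY1 Q u v y1)
    <= cond_relent alt_XY1Y2 t.
Proof.
move=> Hth t tpmf Ht; have [t0 t1] := tpmf.
pose W := ((U * V) * (X * Y1 * Y2))%type.
have mX s : marg (fun w : W => (w.1.1, w.2.1.1)) t s = QUX Q s.1 s.2 := Ht (inl s).
have mY s : marg (fun w : W => (w.1, w.2.1.2)) t s = QUVY1 Q s.1.1 s.1.2 s.2 := Ht (inr (inl s)).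
have mZ s : marg (fun w : W => (w.1, w.2.2)) t s = QUVY2 Q s.1.1 s.1.2 s.2 := Ht (inr (inr s)).
have tX u x : \sum_v \sum_y1 \sum_y2 t (u, v, (x, y1, y2)) = QUX Q u x.
  rewrite -(mX (u, x)) (@marg_fiber _ _ _ (V * Y1 * Y2)%type _ (fun w => (w.1.2, w.2.1.2, w.2.2))
    (fun sr => ((sr.1.1, sr.2.1.1), (sr.1.2, sr.2.1.2, sr.2.2)))).
  - by rewrite !pair_bigA.
  - by move=> [[? ?] [[? ?] ?]].
  - by move=> [[? ?] [[? ?] ?]].
have tY u v y1 : \sum_x \sum_y2 t (u, v, (x, y1, y2)) = QUVY1 Q u v y1.
  rewrite -(mY (u, v, y1)) (@marg_fiber _ _ _ (X * Y2)%type _ (fun w => (w.2.1.1, w.2.2))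
    (fun sr => (sr.1.1, (sr.2.1, sr.1.2, sr.2.2)))).
  - by rewrite !pair_bigA.
  - by move=> [[[? ?] ?] [? ?]].
  - by move=> [[? ?] [[? ?] ?]].
have tZ u v y2 : \sum_x \sum_y1 t (u, v, (x, y1, y2)) = QUVY2 Q u v y2.
  rewrite -(mZ (u, v, y2)) (@marg_fiber _ _ _ (X * Y1)%type _ (fun w => (w.2.1.1, w.2.1.2))
    (fun sr => (sr.1.1, (sr.2.1, sr.2.2, sr.1.2)))).
  - by rewrite !pair_bigA.
  - by move=> [[[? ?] ?] [? ?]].
  - by move=> [[? ?] [[? ?] ?]].
have L2 : in_L2 Q (fun u v x y1 y2 => t (u, v, (x, y1, y2))).
  split=> //; split=> [w|]; first exact: t0.
  rewrite -t1 (reindex (fun w : U * V * X * Y1 * Y2 =>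
    (w.1.1.1.1, w.1.1.1.2, (w.1.1.2, w.1.2, w.2)))) //=.
  by exists (fun w => (w.1.1, w.1.2, w.2.1.1, w.2.1.2, w.2.2)) => [[[[[? ?] ?] ?] ?] _|[[? ?] [[? ?] ?]] _].
have pos u v x y1 y2 : 0 < t (u, v, (x, y1, y2)) ->
    [/\ 0 < QUX Q u x, 0 < QX Q x & 0 < QU u] /\
    [/\ 0 < QUVY1 Q u v y1, 0 < QUY1 Q u y1 & 0 < QUV u v].
  move=> tp; have QUX0 : 0 < QUX Q u x.
    apply: lt_le_trans tp _; rewrite -tX.
    apply: le_trans (@le_sum _ (fun v => \sum_y1 \sum_y2 t (u, v, (x, y1, y2))) v _); last first.
      by move=> ?; do 2![apply: sum_ge0 => ?].
    apply: le_trans (@le_sum _ (fun y1 => \sum_y2 t (u, v, (x, y1, y2))) y1 _); last first.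
      by move=> ?; apply: sum_ge0 => ?.
    by apply: (@le_sum _ (fun y2 => t (u, v, (x, y1, y2)))).
  have QUVY0 : 0 < QUVY1 Q u v y1.
    apply: lt_le_trans tp _; rewrite -tY.
    apply: le_trans (@le_sum _ (fun x => \sum_y2 t (u, v, (x, y1, y2))) x _); last first.
      by move=> ?; apply: sum_ge0 => ?.
    by apply: (@le_sum _ (fun y2 => t (u, v, (x, y1, y2)))).
  split; split=> //.
  - exact: lt_le_trans QUX0 (QUX_le_QX _ _).
  - exact: lt_le_trans QUX0 (QUX_le_QU _ _).
  - exact: lt_le_trans QUVY0 (QUVY1_le_QUY1 _ _ _).
  - exact: lt_le_trans QUVY0 (QUVY1_le_QUV _ _ _).
have := Hth _ L2; rewrite /div2 /KLdiv /=.
case: ifP => [/existsP[[[[[u v] x] y1] y2] /= /andP[tp /eqP]]|_].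
  have [[a b _] [c d _]] := pos _ _ _ _ _ tp.
  by move/eqP; rewrite /Qbar /PU_X /PV_Y1U gt_eqF // ?mulr_gt0 ?invr_gt0 ?mulr_gt0 ?invr_gt0 ?mulr_gt0 ?invr_gt0 ?Pbar_gt0.
rewrite lee_fin (reindex (fun w : W => (w.1.1, w.1.2, w.2.1.1, w.2.1.2, w.2.2))) /=; last first.
  exists (fun w => (w.1.1.1.1, w.1.1.1.2, (w.1.1.2, w.1.2, w.2))) => [[[? ?] [[? ?] ?]] _|[[[[? ?] ?] ?] ?] _] //.
move=> H; have -> : cond_relent alt_XY1Y2 t =
    \sum_(w : W) t w * ln (t w / Qbar Q Pbar w.1.1 w.1.2 w.2.1.1 w.2.1.2 w.2.2)
    + \sum_(w : W) t w * idens1 w.1.1 w.2.1.1 + \sum_(w : W) t w * idens2 w.1.1 w.1.2 w.2.1.2.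
  rewrite -!big_split /=; apply: eq_bigr => -[[u v] [[x y1] y2]] _ /=.
  have [->|tw] := eqVneq (t (u, v, (x, y1, y2))) 0; first by rewrite !mul0r !addr0.
  have tp : 0 < t (u, v, (x, y1, y2)) by rewrite lt0r tw t0.
  have [[a b c] [d e f]] := pos _ _ _ _ _ tp.
  have -> : \sum_b t (u, v, b) = QUV u v.
    rewrite /QUV; under [RHS]eq_bigr do rewrite -tY.
    rewrite [RHS]exchange_big !pair_bigA /=.
    by apply: eq_bigr => -[[? ?] ?] _.
  have Pb := Pbar_gt0 x y1 y2.
  rewrite -!mulrDr /idens1 /idens2 /Qbar /PU_X /PV_Y1U /alt_XY1Y2 /=.
  rewrite -!lnM ?posrE ?mulr_gt0 ?invr_gt0 ?mulr_gt0 ?invr_gt0 ?mulr_gt0 ?invr_gt0 ?mulr_gt0 //.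
  by congr (_ * ln _); field; rewrite !gt_eqF.
have -> : \sum_(w : W) t w * idens1 w.1.1 w.2.1.1 = \sum_s QUX Q s.1 s.2 * idens1 s.1 s.2.
  have := marg_mean (fun w : W => (w.1.1, w.2.1.1)) t (fun s => idens1 s.1 s.2).
  by move=> /= ->; apply: eq_bigr => s _; rewrite mX.
have -> : \sum_(w : W) t w * idens2 w.1.1 w.1.2 w.2.1.2 =
    \sum_s QUVY1 Q s.1.1 s.1.2 s.2 * idens2 s.1.1 s.1.2 s.2.
  have := marg_mean (fun w : W => (w.1, w.2.1.2)) t (fun s => idens2 s.1.1 s.1.2 s.2).
  by move=> /= ->; apply: eq_bigr => s _; rewrite mY.
rewrite mutinf_mean condmutinf_mean; apply: lerD; first apply: lerD.
- by apply: le_trans H _; rewrite le_eqVlt; apply/orP; left; apply/eqP; apply: eq_bigr => -[[? ?] [[? ?] ?]] _.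
- by apply: ler_sum => -[u x] _; rewrite marg_QUX.
- by apply: ler_sum => -[[u v] y1] _; rewrite marg_QUVY1.
Qed.

End SingleLetter.

(** * Codes *)

Section Codebooks.
Variables (R : realType) (X Y1 Y2 : finType) (n : nat).

Let seqs (A : finType) := {ffun 'I_n -> A}.

Lemma iid_prob_le (P : X -> Y1 -> Y2 -> R) (E F : seqs X -> seqs Y1 -> seqs Y2 -> bool) :
  (forall x y1 y2, 0 <= P x y1 y2) -> (forall x y1 y2, E x y1 y2 -> F x y1 y2) ->
  iid_prob P E <= iid_prob P F.
Proof.
move=> P0 EF; apply: ler_sum => x _; apply: ler_sum => y1 _; apply: ler_sum => y2 _.
apply: ler_wpM2l; first exact: prodr_ge0.
by case: (boolP (E x y1 y2)) => [/EF ->|_] //; rewrite ler0n.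
Qed.

Lemma iid_prob_union (P : X -> Y1 -> Y2 -> R) (T : Type) (s : seq T)
    (E : seqs X -> seqs Y1 -> seqs Y2 -> bool) (F : T -> seqs X -> seqs Y1 -> seqs Y2 -> bool) :
  (forall x y1 y2, 0 <= P x y1 y2) ->
  (forall x y1 y2, E x y1 y2 -> has (fun u => F u x y1 y2) s) ->
  iid_prob P E <= \sum_(u <- s) iid_prob P (F u).
Proof.
move=> P0 EF; rewrite /iid_prob.
rewrite [leRHS]exchange_big /=; apply: ler_sum => x _.
rewrite [leRHS]exchange_big /=; apply: ler_sum => y1 _.
rewrite [leRHS]exchange_big /=; apply: ler_sum => y2 _.
rewrite -mulr_sumr; apply: ler_wpM2l; first exact: prodr_ge0.
have hasE (r : seq T) : (has (fun u => F u x y1 y2) r)%:R <= \sum_(u <- r) (F u x y1 y2)%:R :> R.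
  elim: r => [|u r IH]; first by rewrite big_nil.
  rewrite big_cons /=; case: (F u x y1 y2) => /=; last by rewrite add0r.
  by rewrite lerDl sumr_ge0 // => v _; rewrite ler0n.
by case: (boolP (E x y1 y2)) => [/EF Fs|_]; [have := hasE s; rewrite Fs | rewrite sumr_ge0].
Qed.

Lemma sum_seq_le (T : Type) (s : seq T) (F : T -> R) (b : R) :
  (forall u, F u <= b) -> \sum_(u <- s) F u <= (size s)%:R * b.
Proof.
move=> Fb; apply: (@le_trans _ _ (\sum_(u <- s) b)); first exact: ler_sum.
by rewrite big_const_seq count_predT iter_addr_0 mulr_natl.
Qed.

(* The last message signals an encoding failure. *)
Definition encode (T : eqType) (s : seq T) (m : nat) (o : option T) : 'I_m.+1 :=
  inord (if o is Some b then index b s else m).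

(** The failure index [m] lies just beyond the codebook, so [onth] sends it back to [None]. *)
Lemma encodeK (T : eqType) (s : seq T) (m : nat) (o : option T) :
  size s = m -> (forall b, o = Some b -> b \in s) -> onth s (encode s m o) = o.
Proof.
move=> sm; rewrite /encode; case: o => [b|] bs; last first.
  by rewrite inordK // onth_default // sm.
have /[dup] bs' := bs b erefl; rewrite -index_mem sm => lt.
rewrite inordK; last exact: ltnW.
by rewrite onthE (nth_map b) ?sm // nth_index.
Qed.

Variables (P Pbar : X -> Y1 -> Y2 -> R) (U V : eqType).
Hypotheses (P_ge0 : forall x y1 y2, 0 <= P x y1 y2)
  (Pbar_ge0 : forall x y1 y2, 0 <= Pbar x y1 y2).
Variables (tX : U -> seqs X -> bool) (tY : U -> seqs Y1 -> bool)
  (tVY1 : U -> V -> seqs Y1 -> bool) (tVY2 : U -> V -> seqs Y2 -> bool).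

Definition all_typical u v x y1 y2 := [&& tX u x, tY u y1, tVY1 u v y1 & tVY2 u v y2].

Variables (s1 : seq U) (f1 : seqs X -> option U) (s2 : U -> seq V)
  (f2 : U -> seqs Y1 -> option V) (m1 m2 : nat).
Hypotheses (sz1 : size s1 = m1) (sz2 : forall u, size (s2 u) = m2)
  (f1s : forall x u, f1 x = Some u -> u \in s1)
  (f2s : forall u y1 v, f2 u y1 = Some v -> v \in s2 u).

(** Under the null, either detector errs only if some typicality test fails. Under the alternative,
    acceptance forces some codeword of the codebook to pass the tests, whence the union bounds. *)
Lemma code_of_codebooks : exists c : Defs.code X Y1 Y2 n,
  let bad := iid_prob P (fun x y1 y2 =>
    ~~ (if f1 x is Some u then
          if f2 u y1 is Some v then all_typical u v x y1 y2 else false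
        else false)) in
  [/\ size1 c = m1.+1, size2 c = m2.+1, alpha1 P c <= bad, alpha2 P c <= bad &
      beta1 Pbar c <= \sum_(u <- s1) iid_prob Pbar (fun x y1 _ => tX u x && tY u y1) /\
      beta2 Pbar c <= \sum_(u <- s1) \sum_(v <- s2 u)
        iid_prob Pbar (fun x y1 y2 => [&& tX u x, tVY1 u v y1 & tVY2 u v y2])].
Proof.
(* Each test is run where its data are available: the encoder suppresses a [u] atypical with [x],
   and Detector 1 a [v] atypical with [y1]. Detector 2 thus benefits from tests on sequences that it
   does not observe. *)
pose g1 x := if f1 x is Some u then if tX u x then Some u else None else None.
pose g2 u y1 := if f2 u y1 is Some v then if tVY1 u v y1 then Some v else None else None.
have g1P x u : g1 x = Some u -> u \in s1 /\ tX u x.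
  rewrite /g1; case E: (f1 x) => [u'|] //; case: ifP => // t [<-].
  by split => //; exact: f1s E.
have g2P u y1 v : g2 u y1 = Some v -> v \in s2 u /\ tVY1 u v y1.
  rewrite /g2; case E: (f2 u y1) => [v'|] //; case: ifP => // t [<-].
  by split => //; exact: f2s E.
pose c : Defs.code X Y1 Y2 n := {|
  enc1 := fun x => encode s1 m1 (g1 x);
  (* After a first-stage failure the second message is arbitrary, since [dec2] answers [H2]
     anyway. *)
  enc2 := fun i y1 => if onth s1 i is Some u then encode (s2 u) m2 (g2 u y1) else ord_max;
  dec1 := fun i y1 => if onth s1 i is Some u then if tY u y1 then H1 else H2 else H2;
  dec2 := fun i j y2 => if onth s1 i is Some u then
    if onth (s2 u) j is Some v then if tVY2 u v y2 then H1 else H2 else H2 else H2 |}.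
have K1 x : onth s1 (encode s1 m1 (g1 x)) = g1 x.
  by apply: encodeK => // u /g1P[].
have K2 u y1 : onth (s2 u) (encode (s2 u) m2 (g2 u y1)) = g2 u y1.
  by apply: encodeK => // v /g2P[].
have d1 x y1 : dec1_out c x y1 =
    if g1 x is Some u then if tY u y1 then H1 else H2 else H2.
  by rewrite /dec1_out /= K1.
have d2 x y1 y2 : dec2_out c x y1 y2 =
    if g1 x is Some u then
      if g2 u y1 is Some v then if tVY2 u v y2 then H1 else H2 else H2 else H2.
  by rewrite /dec2_out /= K1; case: (g1 x) => // u; rewrite K2.
exists c; split=> //; [| |split].
- apply: iid_prob_le => // x y1 y2; rewrite d1 /g1; case: (f1 x) => // u.
  case: (f2 u y1) => // v; apply: contraTN => /and4P[tx ty _ _].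
  by rewrite tx ty.
- apply: iid_prob_le => // x y1 y2; rewrite d2 /g1; case: (f1 x) => // u.
  case Ef: (f2 u y1) => [v|] //; apply: contraTN => /and4P[tx _ tv tw].
  by rewrite tx /g2 Ef tv tw.
- apply: iid_prob_union => // x y1 y2; rewrite d1; case E: (g1 x) => [u|] //.
  have [us tx] := g1P _ _ E; case: ifP => // ty _.
  by apply/hasP; exists u => //; rewrite tx ty.
- apply: (@le_trans _ _ (\sum_(u <- s1) iid_prob Pbar (fun x y1 y2 =>
      has (fun v => [&& tX u x, tVY1 u v y1 & tVY2 u v y2]) (s2 u)))).
    apply: iid_prob_union => // x y1 y2; rewrite d2; case E: (g1 x) => [u|] //.
    have [us tx] := g1P _ _ E; case F: (g2 u y1) => [v|] //.
    have [vs tv] := g2P _ _ _ F; case: ifP => // tw _.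
    apply/hasP; exists u => //; apply/hasP; exists v => //.
    by apply/and3P.
  by apply: ler_sum => u _; apply: iid_prob_union.
Qed.

End Codebooks.

(** * Typicality and change of measure *)

Section Typicality.
Variable R : realType.

Definition typ n (S : finType) (c : S -> R) (e : R) (s : {ffun 'I_n -> S}) : bool :=
  [forall k, `|emp R s k - c k| <= e].

(** The weak law is applied to the indicator of each letter [s], and the error budget is split among
    the letters. *)
Lemma typ_lln (W S : finType) (q : W -> R) (pi : W -> S) (c : S -> R) (e k : R) :
  is_pmf q -> (forall s, marg pi q s = c s) -> 0 < e -> 0 < k ->
  \forall n \near \oo%classic, \sum_(w : {ffun 'I_n -> W}) (\prod_i q (w i)) *
    (~~ typ c e [ffun i => pi (w i)])%:R <= k.
Proof.
move=> qpmf qc e0 k0; have [q0 _] := qpmf.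
have k'0 : 0 < k / #|S|.+1%:R by rewrite divr_gt0.
near=> n.
have H s : \sum_(w : {ffun 'I_n -> W}) (\prod_i q (w i)) *
     (e < `|avg (fun i => (pi (w i) == s)%:R) - c s|)%R%:R <= k / #|S|.+1%:R.
  move: s; near: n; apply: filter_forall => s; rewrite -qc.
  exact: (weak_lln qpmf (fun w => (pi w == s)%:R) e0 k'0).
apply: (@le_trans _ _ (\sum_(s : S) k / #|S|.+1%:R)); last first.
  by rewrite sumr_const -[leLHS]mulr_natr -mulrA ler_piMr ?(ltW k0) // ler_pdivrMl // mulr1 ler_nat.
apply: le_trans (ler_sum _ (fun s _ => H s)); rewrite exchange_big /=.
apply: ler_sum => w _; rewrite -mulr_sumr ler_wpM2l ?prodr_ge0 //.
case: (boolP (typ _ _ _)) => [_|]; first by rewrite sumr_ge0 // => s _; rewrite ler0n.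
rewrite negb_forall => /existsP[s]; rewrite -ltNge => Hs.
rewrite (bigD1 s) //= /emp in Hs *.
have -> : (fun i => (pi (w i) == s)%:R) = (fun i => ([ffun i => pi (w i)] i == s)%:R) :> ('I_n -> R).
  by apply/funext => i; rewrite ffunE.
by rewrite Hs lerDl sumr_ge0 // => s' _; rewrite ler0n.
Unshelve. all: by end_near. Qed.

Lemma prod_tilt n (a b g : 'I_n -> R) (r : R) :
  (forall i, 0 <= b i) -> (forall i, a i = b i * expR (g i)) -> avg g <= r ->
  \prod_i a i <= expR (n%:R * r) * \prod_i b i.
Proof.
move=> b0 abg gr; rewrite (eq_bigr _ (fun i _ => abg i)) big_split /= mulrC.
apply: ler_wpM2r; first exact: prodr_ge0.
(* For [n = 0] both sides are trivial, while [avg] divides by 0. *)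
rewrite -expR_sum ler_expR; have [n0|n0] := posnP n.
  by rewrite big1 ?n0 ?mul0r // => i; have := ltn_ord i; rewrite [X in (_ < X)%N]n0.
by rewrite mulrC -ler_pdivrMr ?ltr0n.
Qed.

End Typicality.

(** * Assembly of the block codes *)

Section Assembly.
Variables (R : realType) (X Y1 Y2 U V : finType).
Variable Q : U -> V -> X -> Y1 -> Y2 -> R.
Variables (P : X -> Y1 -> Y2 -> R) (R1 R2 : R).
Hypothesis HQ : in_S Q P R1 R2.

Let L := letter X Y1 Y2 U V.
Let I1 := mutinf (QUX Q).
Let I2 := condmutinf (fun v y1 u => QUVY1 Q u v y1).

Section Blocks.
Variable n : nat.
Let seqs (A : finType) := {ffun 'I_n -> A}.

Definition Pn (x : seqs X) (y1 : seqs Y1) (y2 : seqs Y2) : R := \prod_i P (x i) (y1 i) (y2 i).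
Definition chan1 (x : seqs X) (u : seqs U) : R := \prod_i PU_X Q (u i) (x i).
Definition chan2 (u : seqs U) (y1 : seqs Y1) (v : seqs V) : R := \prod_i PV_Y1U Q (v i) (y1 i) (u i).
Definition words1 (u : seqs U) : R := \prod_i QU Q (u i).
(** The memoryless law with letter law [P_{V|U}], from which the second codebook of [u] is drawn. *)
Definition words2 (u : seqs U) (v : seqs V) : R := \prod_i (QUV Q (u i) (v i) / QU Q (u i)).

Lemma joint_prob_seq (E : seqs U -> seqs V -> seqs X -> seqs Y1 -> seqs Y2 -> bool) :
  joint_prob Pn chan1 chan2 E = \sum_(w : {ffun 'I_n -> L}) (\prod_i Qw Q (w i)) *
    (E [ffun i => lu (w i)] [ffun i => lv (w i)] [ffun i => lx (w i)]
       [ffun i => ly1 (w i)] [ffun i => ly2 (w i)])%:R.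
Proof.
rewrite /joint_prob !pair_bigA /= (reindex (fun w : {ffun 'I_n -> L} =>
  ([ffun i => lx (w i)], [ffun i => ly1 (w i)], [ffun i => ly2 (w i)],
   [ffun i => lu (w i)], [ffun i => lv (w i)]))) /=.
  apply: eq_bigr => w _; congr (_ * _).
  rewrite /joint /Pn /chan1 /chan2 -!big_split /=; apply: eq_bigr => i _.
  by rewrite !ffunE (P_PU_X_PV_Y1U HQ).
exists (fun s : seqs X * seqs Y1 * seqs Y2 * seqs U * seqs V =>
  [ffun i => (s.1.1.1.1 i, s.1.1.1.2 i, s.1.1.2 i, s.1.2 i, s.2 i)]).
  by move=> w _; apply/ffunP => i; rewrite !ffunE /=; case: (w i) => [[[[? ?] ?] ?] ?].
move=> [[[[x y1] y2] u] v] _ /=; congr (_, _, _, _, _); apply/ffunP => i; by rewrite !ffunE.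
Qed.

(** Only sequences whose letters all lie in the support of [Q] matter, so logarithms of densities
    may be taken freely. *)
Lemma joint_prob_le_seq (E : seqs U -> seqs V -> seqs X -> seqs Y1 -> seqs Y2 -> bool)
    (F : {ffun 'I_n -> L} -> bool) :
  (forall w : {ffun 'I_n -> L}, (forall i, 0 < Qw Q (w i)) ->
    E [ffun i => lu (w i)] [ffun i => lv (w i)] [ffun i => lx (w i)]
       [ffun i => ly1 (w i)] [ffun i => ly2 (w i)] -> F w) ->
  joint_prob Pn chan1 chan2 E <= \sum_(w : {ffun 'I_n -> L}) (\prod_i Qw Q (w i)) * (F w)%:R.
Proof.
move=> EF; rewrite joint_prob_seq; apply: ler_sum => w _.
have [q0 _] := Qw_pmf HQ.
have [e|ne] := eqVneq (\prod_i Qw Q (w i)) 0; first by rewrite e !mul0r.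
have wp i : 0 < Qw Q (w i).
  rewrite lt0r q0 andbT; apply: contra_neq ne => qi.
  by rewrite (bigD1 i) //= qi mul0r.
apply: ler_wpM2l; first exact: prodr_ge0.
by case: (boolP (E _ _ _ _ _)) => [/(EF w wp) ->|_] //; rewrite ler0n.
Qed.

End Blocks.

Let lln_event (g : L -> R) (d : R) n (w : {ffun 'I_n -> L}) : bool :=
  d < `|avg (fun i => g (w i)) - \sum_a Qw Q a * g a|.

(** The channel density against the codeword law is the exponential of a sum of information
    densities. By the weak law it rarely exceeds [expR (n * (I1 + d))]. *)
Lemma density1_near d k : 0 < d -> 0 < k -> \forall n \near \oo%classic,
  joint_prob (@Pn n) (@chan1 n) (@chan2 n)
    (fun u _ x _ _ => ~~ (chan1 x u <= expR (n%:R * (I1 + d)) * words1 u)) <= k.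
Proof.
move=> d0 k0.
have := weak_lln (Qw_pmf HQ) (fun w => idens1 Q (lu w) (lx w)) d0 k0.
apply: filterS => n; apply: le_trans.
apply: (@joint_prob_le_seq n _ (@lln_event (fun w => idens1 Q (lu w) (lx w)) d n)) => w wp.
apply: contraR; rewrite -leNgt => H.
apply: (@prod_tilt _ _ _ _ (fun i => idens1 Q (lu (w i)) (lx (w i)))) => [i|i|].
- by rewrite (QU_ge0 HQ).
- rewrite !ffunE; have := wp i; rewrite /Qw => qp.
  have a := lt_le_trans qp (Q_le_QUX HQ _ _ _ _ _).
  have b := lt_le_trans a (QUX_le_QU HQ _ _); have c := lt_le_trans a (QUX_le_QX HQ _ _).
  rewrite /idens1 lnK ?posrE ?divr_gt0 ?mulr_gt0 // /PU_X.
  by field; rewrite !gt_eqF.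
- rewrite addrC -lerBlDr; apply: le_trans (ler_norm _) _; apply: le_trans H.
  rewrite /I1 mutinf_mean.
  by have /= <- := marg_mean (fun w => (lu w, lx w)) (Qw Q) (fun s => idens1 Q s.1 s.2).
Qed.

Lemma density2_near d k : 0 < d -> 0 < k -> \forall n \near \oo%classic,
  joint_prob (@Pn n) (@chan1 n) (@chan2 n)
    (fun u v _ y1 _ => ~~ (chan2 u y1 v <= expR (n%:R * (I2 + d)) * words2 u v)) <= k.
Proof.
move=> d0 k0.
have := weak_lln (Qw_pmf HQ) (fun w => idens2 Q (lu w) (lv w) (ly1 w)) d0 k0.
apply: filterS => n; apply: le_trans.
apply: (@joint_prob_le_seq n _ (@lln_event (fun w => idens2 Q (lu w) (lv w) (ly1 w)) d n)) => w wp.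
apply: contraR; rewrite -leNgt => H.
apply: (@prod_tilt _ _ _ _ (fun i => idens2 Q (lu (w i)) (lv (w i)) (ly1 (w i)))) => [i|i|].
- by rewrite divr_ge0 ?(QU_ge0 HQ) ?(QUV_ge0 HQ).
- rewrite !ffunE; have := wp i; rewrite /Qw => qp.
  have a := lt_le_trans qp (Q_le_QUVY1 HQ _ _ _ _ _).
  have b := lt_le_trans a (QUVY1_le_QUV HQ _ _ _); have c := lt_le_trans a (QUVY1_le_QUY1 HQ _ _ _).
  have e := lt_le_trans b (QUV_le_QU HQ _ _).
  rewrite /idens2 lnK ?posrE ?divr_gt0 ?mulr_gt0 // /PV_Y1U.
  by field; rewrite !gt_eqF.
- rewrite addrC -lerBlDr; apply: le_trans (ler_norm _) _; apply: le_trans H.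
  rewrite /I2 condmutinf_mean.
  by have /= <- := marg_mean (fun w => (lu w, lv w, ly1 w)) (Qw Q) (fun s => idens2 Q s.1.1 s.1.2 s.2).
Qed.

Section Typical.
Variables (e : R).
Definition typUX n (u : {ffun 'I_n -> U}) (x : {ffun 'I_n -> X}) :=
  typ (fun s => QUX Q s.1 s.2) e (zipf u x).
Definition typUY1 n (u : {ffun 'I_n -> U}) (y1 : {ffun 'I_n -> Y1}) :=
  typ (fun s => QUY1 Q s.1 s.2) e (zipf u y1).
Definition typUVY1 n (u : {ffun 'I_n -> U}) (v : {ffun 'I_n -> V}) (y1 : {ffun 'I_n -> Y1}) :=
  typ (fun s => QUVY1 Q s.1.1 s.1.2 s.2) e (zipf (zipf u v) y1).
Definition typUVY2 n (u : {ffun 'I_n -> U}) (v : {ffun 'I_n -> V}) (y2 : {ffun 'I_n -> Y2}) :=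
  typ (fun s => QUVY2 Q s.1.1 s.1.2 s.2) e (zipf (zipf u v) y2).

Lemma atypical_near k : 0 < e -> 0 < k -> \forall n \near \oo%classic,
  joint_prob (@Pn n) (@chan1 n) (@chan2 n) (fun u v x y1 y2 =>
    ~~ all_typical (@typUX n) (@typUY1 n) (@typUVY1 n) (@typUVY2 n) u v x y1 y2) <= k.
Proof.
move=> e0 k0; have k4 : 0 < k / 4 by rewrite divr_gt0.
have A := typ_lln (c := fun s => QUX Q s.1 s.2) (Qw_pmf HQ) (pi := fun w => (lu w, lx w)) _ e0 k4.
have B := typ_lln (c := fun s => QUY1 Q s.1 s.2) (Qw_pmf HQ) (pi := fun w => (lu w, ly1 w)) _ e0 k4.
have C := typ_lln (c := fun s => QUVY1 Q s.1.1 s.1.2 s.2)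
  (Qw_pmf HQ) (pi := fun w => (lu w, lv w, ly1 w)) _ e0 k4.
have D := typ_lln (c := fun s => QUVY2 Q s.1.1 s.1.2 s.2)
  (Qw_pmf HQ) (pi := fun w => (lu w, lv w, ly2 w)) _ e0 k4.
near=> n.
rewrite joint_prob_seq.
have -> : k = k / 4 + (k / 4 + (k / 4 + k / 4)) by lra.
pose bad (S : finType) (c : S -> R) (pi : L -> S) : R := \sum_(w : {ffun 'I_n -> L})
  (\prod_i Qw Q (w i)) * (~~ typ c e [ffun i => pi (w i)])%:R.
apply: (@le_trans _ _ (bad _ (fun s => QUX Q s.1 s.2) (fun w => (lu w, lx w))
  + (bad _ (fun s => QUY1 Q s.1 s.2) (fun w => (lu w, ly1 w))
  + (bad _ (fun s => QUVY1 Q s.1.1 s.1.2 s.2) (fun w => (lu w, lv w, ly1 w))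
  + bad _ (fun s => QUVY2 Q s.1.1 s.1.2 s.2) (fun w => (lu w, lv w, ly2 w)))))); last first.
  apply: lerD; first by rewrite /bad; near: n; apply: A => -[? ?]; exact: marg_QUX.
  apply: lerD; first by rewrite /bad; near: n; apply: B => -[? ?]; exact: marg_QUY1.
  apply: lerD; first by rewrite /bad; near: n; apply: C => -[[? ?] ?]; exact: marg_QUVY1.
  by rewrite /bad; near: n; apply: D => -[[? ?] ?]; exact: marg_QUVY2.
rewrite -!big_split /=; apply: ler_sum => w _; rewrite -!mulrDr.
have [q0 _] := Qw_pmf HQ.
apply: ler_wpM2l; first exact: prodr_ge0.
rewrite /all_typical /typUX /typUY1 /typUVY1 /typUVY2.
have z2 (A' B' : finType) (f : L -> A') (g : L -> B') :
    zipf [ffun i => f (w i)] [ffun i => g (w i)] = [ffun i => (f (w i), g (w i))].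
  by apply/ffunP => i; rewrite !ffunE.
rewrite !z2 !(z2 _ _ (fun w => (lu w, lv w))).
rewrite !negb_and -!natrD ler_nat.
by do 4![case: (typ _ _ _) => //=].
Unshelve. all: by end_near. Qed.
End Typical.


Section BlockCode.
Variables (n : nat) (e : R) (u0 : U) (v0 : V) (K1 K2 k : R) (m1 m2 : nat).
Hypothesis P_pmf : is_pmf (fun w : X * Y1 * Y2 => P w.1.1 w.1.2 w.2).
Hypotheses (K1_gt0 : 0 < K1) (K2_gt0 : 0 < K2)
  (k1 : expR (- (m1%:R / (2 * K1))) <= k) (k2 : expR (- (m2%:R / (2 * K2))) <= k).

Let good := all_typical (@typUX e n) (@typUY1 e n) (@typUVY1 e n) (@typUVY2 e n).

Lemma block_codebooks :
  exists (s1 : seq {ffun 'I_n -> U}) (f1 : {ffun 'I_n -> X} -> option {ffun 'I_n -> U})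
    (s2 : {ffun 'I_n -> U} -> seq {ffun 'I_n -> V})
    (f2 : {ffun 'I_n -> U} -> {ffun 'I_n -> Y1} -> option {ffun 'I_n -> V}),
    [/\ size s1 = m1, forall x u, f1 x = Some u -> u \in s1,
        forall u, size (s2 u) = m2, forall u y1 v, f2 u y1 = Some v -> v \in s2 u &
    \sum_x \sum_y1 \sum_y2 Pn x y1 y2 *
      (~~ (if f1 x is Some u then
             if f2 u y1 is Some v then good u v x y1 y2 else false
           else false))%:R
    <= 4 * joint_prob (@Pn n) (@chan1 n) (@chan2 n) (fun u v x y1 y2 => ~~ good u v x y1 y2)
     + 4 * joint_prob (@Pn n) (@chan1 n) (@chan2 n)
         (fun u v _ y1 _ => ~~ (chan2 u y1 v <= K2 * words2 u v))
     + 2 * joint_prob (@Pn n) (@chan1 n) (@chan2 n)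
         (fun u _ x _ _ => ~~ (chan1 x u <= K1 * words1 u)) + 3 * k].
Proof.
have P0 := P_ge0 HQ; have PU0 := PU_X_ge0 HQ; have PV0 := PV_Y1U_ge0 HQ.
apply: (@two_stage_code R _ _ _ _ _ [ffun=> u0] [ffun=> v0] (@Pn n) (@words1 n)
  (@chan1 n) (@words2 n) (@chan2 n)) => //.
- by move=> x y1 y2; rewrite prodr_ge0.
- by move=> u; rewrite prodr_ge0 // => i _; rewrite (QU_ge0 HQ).
- rewrite (sum_prod_ffun (fun _ => QU Q)) prodr_ile1 // => i _.
  by rewrite (sum_QU HQ) lexx ler01.
- by move=> u v; rewrite prodr_ge0 // => i _; rewrite divr_ge0 ?(QU_ge0 HQ) ?(QUV_ge0 HQ).
- move=> u; rewrite (sum_prod_ffun (fun i y => QUV Q (u i) y / QU Q (u i))) prodr_ile1 // => i _.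
  rewrite -mulr_suml sum_QUV divr_ge0 ?(QU_ge0 HQ) //=.
  by have [->|ne] := eqVneq (QU Q (u i)) 0; rewrite ?mul0r ?divff.
- by move=> x u; rewrite prodr_ge0.
- move=> x; rewrite (sum_prod_ffun (fun i y => PU_X Q y (x i))) prodr_ile1 // => i _.
  by rewrite (sum_PU_X_le1 Q) sumr_ge0.
- by move=> u y1 v; rewrite prodr_ge0.
- move=> u y1; rewrite (sum_prod_ffun (fun i y => PV_Y1U Q y (y1 i) (u i))) prodr_ile1 // => i _.
  by rewrite (sum_PV_Y1U_le1 Q) sumr_ge0.
- have <- : \prod_(i < n) \sum_x \sum_y1 \sum_y2 P x y1 y2 = 1.
    by rewrite big1 // => i _; have [_ <-] := P_pmf; rewrite !pair_bigA.
  rewrite -(sum_prod_ffun (fun _ x => \sum_y1 \sum_y2 P x y1 y2)).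
  apply: ler_sum => x _.
  rewrite -(sum_prod_ffun (fun i y1 => \sum_y2 P (x i) y1 y2)).
  apply: ler_sum => y1 _.
  by rewrite -(sum_prod_ffun (fun i y2 => P (x i) (y1 i) y2)).
- move=> x y1 y2; rewrite (sum_prod_ffun (fun i y => PU_X Q y (x i))) /Pn -big_split /=.
  by apply: eq_bigr => i _; rewrite (P_sum_PU_X HQ).
- move=> x y1 y2 u; rewrite (sum_prod_ffun (fun i y => PV_Y1U Q y (y1 i) (u i))).
  rewrite /Pn /chan1 -!big_split /=.
  by apply: eq_bigr => i _; rewrite (P_PU_X_sum_PV_Y1U HQ).
Qed.

End BlockCode.

Variable Pbar : X -> Y1 -> Y2 -> R.
Hypothesis Pbar_gt0 : forall x y1 y2, 0 < Pbar x y1 y2.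

Let Pbar_prod_ge0 n (x : {ffun 'I_n -> X}) (y1 : {ffun 'I_n -> Y1}) (y2 : {ffun 'I_n -> Y2}) :
  0 <= \prod_i Pbar (x i) (y1 i) (y2 i).
Proof. by rewrite prodr_ge0 // => i _; rewrite ltW. Qed.

(** Summing out [y2] leaves independent pairs with law [alt_XY1], and the two typicality tests are
    the constraints of [test1]. *)
Lemma typ_prob1 n (u : {ffun 'I_n -> U}) (e e' : R) : e <= e' ->
  iid_prob Pbar (fun x y1 _ => typUX e u x && typUY1 e u y1) <=
  \sum_(b : {ffun 'I_n -> X * Y1}) (\prod_i alt_XY1 Pbar (b i)) *
    [forall k, `|avg (fun i => test1 R k (u i, b i)) - target1 Q k| <= e']%:R.
Proof.
move=> ee'.
have -> : iid_prob Pbar (fun x y1 _ => typUX e u x && typUY1 e u y1) =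
    \sum_(x : {ffun 'I_n -> X}) \sum_(y1 : {ffun 'I_n -> Y1})
      (\prod_i alt_XY1 Pbar (x i, y1 i)) * (typUX e u x && typUY1 e u y1)%:R.
  apply: eq_bigr => x _; apply: eq_bigr => y1 _.
  rewrite -mulr_suml; congr (_ * _).
  by rewrite (sum_prod_ffun (fun i y2 => Pbar (x i) (y1 i) y2)).
rewrite sum_ffun_pair; apply: ler_sum => b _.
have -> : \prod_i alt_XY1 Pbar ([ffun i => (b i).1] i, [ffun i => (b i).2] i) =
    \prod_i alt_XY1 Pbar (b i).
  by apply: eq_bigr => i _; rewrite !ffunE -surjective_pairing.
apply: ler_wpM2l.
  by rewrite prodr_ge0 // => i _; apply: sumr_ge0 => y2 _; exact: ltW.
case: (boolP (_ && _)) => [/andP[/forallP tX /forallP tY]|_]; last by rewrite ler0n.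
rewrite (_ : [forall k, _] = true) //; apply/forallP => -[s|s]; apply: le_trans ee'.
  have := tX s; rewrite /emp; congr (is_true (`|avg _ - _| <= _)).
  by apply/funext => i; rewrite !ffunE.
have := tY s; rewrite /emp; congr (is_true (`|avg _ - _| <= _)).
by apply/funext => i; rewrite !ffunE.
Qed.

Lemma typ_prob2 n (u : {ffun 'I_n -> U}) (v : {ffun 'I_n -> V}) (e e' : R) : e <= e' ->
  iid_prob Pbar (fun x y1 y2 => [&& typUX e u x, typUVY1 e u v y1 & typUVY2 e u v y2]) <=
  \sum_(b : {ffun 'I_n -> X * Y1 * Y2}) (\prod_i alt_XY1Y2 Pbar (b i)) *
    [forall k, `|avg (fun i => test2 R k (zipf u v i, b i)) - target2 Q k| <= e']%:R.
Proof.
move=> ee'; rewrite /iid_prob !pair_bigA /= (reindex (fun w : {ffun 'I_n -> X * Y1 * Y2} =>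
  ([ffun i => (w i).1.1], [ffun i => (w i).1.2], [ffun i => (w i).2]))) /=; last first.
  exists (fun s : {ffun 'I_n -> X} * {ffun 'I_n -> Y1} * {ffun 'I_n -> Y2} =>
    [ffun i => (s.1.1 i, s.1.2 i, s.2 i)]).
    by move=> w _; apply/ffunP => i; rewrite !ffunE /=; case: (w i) => [[? ?] ?].
  by move=> [[x y1] y2] _ /=; congr (_, _, _); apply/ffunP => i; rewrite !ffunE.
apply: ler_sum => b _; rewrite (eq_bigr (fun i => alt_XY1Y2 Pbar (b i))); last first.
  by move=> i _; rewrite !ffunE.
apply: ler_wpM2l; first by rewrite prodr_ge0 // => i _; rewrite /alt_XY1Y2 ltW.
case: (boolP [&& _, _ & _]) => [/and3P[/forallP tX /forallP tY /forallP tZ]|_]; last by rewrite ler0n.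
rewrite (_ : [forall k, _] = true) //; apply/forallP => -[s|[s|s]]; apply: le_trans ee'.
- have := tX s; rewrite /emp; congr (is_true (`|avg _ - _| <= _)).
  by apply/funext => i; rewrite !ffunE.
- have := tY s; rewrite /emp; congr (is_true (`|avg _ - _| <= _)).
  by apply/funext => i; rewrite !ffunE.
- have := tZ s; rewrite /emp; congr (is_true (`|avg _ - _| <= _)).
  by apply/funext => i; rewrite !ffunE.
Qed.


Variables (th1 th2 : R).
Hypotheses
  (P_pmf : is_pmf (fun w : X * Y1 * Y2 => P w.1.1 w.1.2 w.2))
  (Hth1 : forall t, in_L1 Q t -> (th1%:E <= div1 Q Pbar t)%E)
  (Hth2 : forall t, in_L2 Q t -> (th2%:E <= div2 Q Pbar t)%E).

(** The 13 is 4 + 4 + 2 + 3 from [two_stage_code]. Each codebook costs [3 * d] in rate: one [d] for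
    the density threshold, one for the surplus of codewords, one for rounding. The exponents lose
    this once for Detector 1 and twice for Detector 2, plus [d] for the number of types and [d] for
    the compactness slack, that is 5 and 8. *)
Lemma near_code (d k : R) : 0 < d -> 0 < k ->
  \forall n \near \oo%classic, exists c : Defs.code X Y1 Y2 n,
    [/\ alpha1 P c <= 13 * k, alpha2 P c <= 13 * k,
        beta1 Pbar c <= expR (- (n%:R * (th1 - 5 * d))) /\
        beta2 Pbar c <= expR (- (n%:R * (th2 - 8 * d))),
        0 < ((size1 c)%:R : R) <= expR (n%:R * (R1 + 3 * d)) &
        0 < ((size2 c)%:R : R) <= expR (n%:R * (R2 + 3 * d))].
Proof.
move=> d0 k0.
(* The mass of [Q] is 1, so no alphabet is empty; [w0] supplies the default codewords. *)
have [w0 _] : exists w : L, True.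
  have [w _|no] := pickP (@predT L); first by exists w.
  have [_] := Qw_pmf HQ; rewrite big1 => [/eqP|w]; first by rewrite eq_sym oner_eq0.
  by have := no w.
have altp b : 0 < alt_XY1 Pbar b.
  rewrite /alt_XY1 (bigD1 (ly2 w0)) //= ltr_wpDr ?Pbar_gt0 //.
  by apply: sumr_ge0 => y2 _; exact: ltW.
have [e1 e10 He1] := constrained_prob altp (exponent1 HQ altp Hth1) d0.
have altp2 b : 0 < alt_XY1Y2 Pbar b by exact: Pbar_gt0.
have [e2 e20 He2] := constrained_prob altp2 (exponent2 HQ Pbar_gt0 Hth2) d0.
(* A single typicality radius fine enough for both exponents. *)
pose e := Num.min e1 e2.
have e0 : 0 < e by rewrite lt_min e10.
have i1 : 0 <= I1 + d + d by rewrite !addr_ge0 ?(mutinf_ge0 HQ) ?ltW.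
have i2 : 0 <= I2 + d + d by rewrite !addr_ge0 ?(condmutinf_ge0 HQ) ?ltW.
have [_ [_ [_ [_ [IR1 IR2]]]]] := HQ.
near=> n.
have n0 : (0 < n)%N by near: n; exact: nbhs_infty_gt.
set m1 := nwords n (I1 + d + d); set m2 := nwords n (I2 + d + d).
have C1 : expR (- (m1%:R / (2 * expR (n%:R * (I1 + d))))) <= k.
  by rewrite /m1; near: n; exact: nwords_covers.
have C2 : expR (- (m2%:R / (2 * expR (n%:R * (I2 + d))))) <= k.
  by rewrite /m2; near: n; exact: nwords_covers.
have S1 : m1.+1%:R <= expR (n%:R * (I1 + d + d + d)).
  by rewrite /m1; near: n; exact: nwords_le.
have S2 : m2.+1%:R <= expR (n%:R * (I2 + d + d + d)).
  by rewrite /m2; near: n; exact: nwords_le.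
have [s1 [f1 [s2 [f2 [sz1 f1s sz2 f2s bad]]]]] := @block_codebooks n e (lu w0) (lv w0)
  (expR (n%:R * (I1 + d))) (expR (n%:R * (I2 + d))) k m1 m2 P_pmf (expR_gt0 _) (expR_gt0 _) C1 C2.
have [c [c1 c2 a1 a2 [b1 b2]]] := code_of_codebooks (P_ge0 HQ) (fun x y1 y2 => ltW (Pbar_gt0 x y1 y2))
  (@typUX e n) (@typUY1 e n) (@typUVY1 e n) (@typUVY2 e n) sz1 sz2 f1s f2s.
have {}bad : iid_prob P (fun x y1 y2 => ~~ (if f1 x is Some u then
    if f2 u y1 is Some v then all_typical (@typUX e n) (@typUY1 e n) (@typUVY1 e n) (@typUVY2 e n) u v x y1 y2
    else false else false)) <= 13 * k.
  apply: le_trans bad _.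
  have A : joint_prob (@Pn n) (@chan1 n) (@chan2 n) (fun u v x y1 y2 =>
      ~~ all_typical (@typUX e n) (@typUY1 e n) (@typUVY1 e n) (@typUVY2 e n) u v x y1 y2) <= k.
    by near: n; exact: atypical_near.
  have B : joint_prob (@Pn n) (@chan1 n) (@chan2 n)
      (fun u _ x _ _ => ~~ (chan1 x u <= expR (n%:R * (I1 + d)) * words1 u)) <= k.
    by near: n; exact: density1_near.
  have D : joint_prob (@Pn n) (@chan1 n) (@chan2 n)
      (fun u v _ y1 _ => ~~ (chan2 u y1 v <= expR (n%:R * (I2 + d)) * words2 u v)) <= k.
    by near: n; exact: density2_near.
  by lra.
have poly1 : n.+1%:R ^+ #|{: U * (X * Y1)}| <= expR (n%:R * d).
  by near: n; exact: near_poly_le_exp.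
have poly2 : n.+1%:R ^+ #|{: U * V * (X * Y1 * Y2)}| <= expR (n%:R * d).
  by near: n; exact: near_poly_le_exp.
have M1 : m1%:R <= expR (n%:R * (I1 + d + d + d)).
  by apply: le_trans S1; rewrite ler_nat.
have M2 : m2%:R <= expR (n%:R * (I2 + d + d + d)).
  by apply: le_trans S2; rewrite ler_nat.
exists c; split.
- exact: le_trans a1 bad.
- exact: le_trans a2 bad.
- split.
    apply: (le_trans b1).
    pose B : R := expR (n%:R * d) * expR (- (n%:R * (th1 + I1 - d))).
    have HB (u : {ffun 'I_n -> U}) : iid_prob Pbar (fun x y1 _ => typUX e u x && typUY1 e u y1) <= B.
      apply: (le_trans (@typ_prob1 n u e e1 _)); first by rewrite ge_min lexx.
      by apply: (le_trans (He1 n u n0)); rewrite ler_wpM2r ?expR_ge0.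
    apply: (le_trans (sum_seq_le s1 HB)); rewrite sz1.
    apply: (@le_trans _ _ (expR (n%:R * (I1 + d + d + d)) * B)).
      by rewrite ler_wpM2r // mulr_ge0 ?expR_ge0.
    by rewrite /B -!expRD ler_expR; lra.
  apply: (le_trans b2).
  pose B : R := expR (n%:R * d) * expR (- (n%:R * (th2 + I1 + I2 - d))).
  have HB (u : {ffun 'I_n -> U}) (v : {ffun 'I_n -> V}) :
      iid_prob Pbar (fun x y1 y2 => [&& typUX e u x, typUVY1 e u v y1 & typUVY2 e u v y2]) <= B.
    apply: (le_trans (@typ_prob2 n u v e e2 _)); first by rewrite ge_min lexx orbT.
    by apply: (le_trans (He2 n (zipf u v) n0)); rewrite ler_wpM2r ?expR_ge0.
  have HB' (u : {ffun 'I_n -> U}) : \sum_(v <- s2 u) iid_prob Pbar (fun x y1 y2 =>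
      [&& typUX e u x, typUVY1 e u v y1 & typUVY2 e u v y2]) <= m2%:R * B.
    by apply: (le_trans (sum_seq_le (s2 u) (HB u))); rewrite sz2.
  apply: (le_trans (sum_seq_le s1 HB')); rewrite sz1.
  have B0 : 0 <= B by rewrite mulr_ge0 ?expR_ge0.
  apply: (@le_trans _ _ (expR (n%:R * (I1 + d + d + d)) * (expR (n%:R * (I2 + d + d + d)) * B))).
    by apply: ler_pM => //; [rewrite mulr_ge0 | exact: ler_wpM2r].
  by rewrite /B -!expRD ler_expR; lra.
- rewrite c1 ltr0n /=; apply: (le_trans S1); rewrite ler_expR ler_wpM2l //.
  by rewrite -/I1 in IR1; lra.
- rewrite c2 ltr0n /=; apply: (le_trans S2); rewrite ler_expR ler_wpM2l //.
  by rewrite -/I2 in IR2; lra.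
Unshelve. all: by end_near. Qed.

Lemma in_S_achievable (eps1 eps2 : R) : 0 < eps1 -> 0 < eps2 ->
  achievable P Pbar R1 R2 eps1 eps2 (th1, th2).
Proof.
move=> e1 e2.
pose good d n (c : Defs.code X Y1 Y2 n) :=
  [/\ alpha1 P c <= eps1, alpha2 P c <= eps2,
      ((th1 - d)%:E <= neglog_rate n (beta1 Pbar c))%E /\
      ((th2 - d)%:E <= neglog_rate n (beta2 Pbar c))%E,
      ln (size1 c)%:R / n%:R <= R1 + d & ln (size2 c)%:R / n%:R <= R2 + d].
have mono d d' n (c : Defs.code X Y1 Y2 n) : d <= d' -> good d n c -> good d' n c.
  move=> dd' [a b [f g] h i]; split=> //.
  - by split; [apply: le_trans f | apply: le_trans g]; rewrite lee_fin lerD2l lerN2.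
  - by apply: le_trans h _; rewrite lerD2l.
  - by apply: le_trans i _; rewrite lerD2l.
have rate n (b r : R) : (0 < n)%N -> 0 <= b -> b <= expR (- (n%:R * r)) ->
    (r%:E <= neglog_rate n b)%E.
  move=> n0 b0 br; rewrite /neglog_rate; case: eqP => [_|/eqP bn]; first by rewrite leey.
  have bp : 0 < b by rewrite lt0r bn.
  by rewrite lee_fin ler_pdivlMr ?ltr0n // lerNr mulrC -[leRHS]expRK ler_ln ?posrE ?expR_gt0.
have lnr n (m : nat) (r : R) : (0 < n)%N -> 0 < (m%:R : R) <= expR (n%:R * r) -> ln m%:R / n%:R <= r.
  move=> n0 /andP[m0 mr]; rewrite ler_pdivrMr ?ltr0n // mulrC -[leRHS]expRK.
  by rewrite ler_ln ?posrE ?expR_gt0.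
have beta_ge0 n (E : {ffun 'I_n -> X} -> {ffun 'I_n -> Y1} -> {ffun 'I_n -> Y2} -> bool) :
    0 <= iid_prob Pbar E.
  by do 3![apply: sumr_ge0 => ? _]; rewrite mulr_ge0 ?ler0n ?Pbar_prod_ge0.
pose dflt n : Defs.code X Y1 Y2 n := {|
  enc1 := fun=> ord0 : 'I_1; enc2 := fun _ _ => ord0 : 'I_1;
  dec1 := fun _ _ => H1; dec2 := fun _ _ _ => H1 |}.
have ex d : 0 < d -> \forall n \near \oo%classic, exists c : Defs.code X Y1 Y2 n, good d n c.
  (* The 13 is undone here, and [d / 8] below undoes the largest loss, so the errors are within
     [eps1] and [eps2] themselves and all slacks within [d]. *)
  move=> d0; pose k := Num.min eps1 eps2 / 13.
  have k0 : 0 < k by rewrite divr_gt0 // lt_min e1.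
  have kE : 13 * k = Num.min eps1 eps2 by rewrite /k; field.
  near=> n.
  have n0 : (0 < n)%N by near: n; exact: nbhs_infty_gt.
  have [c [a1 a2 [b1 b2] s1 s2]] : exists c : Defs.code X Y1 Y2 n,
    [/\ alpha1 P c <= 13 * k, alpha2 P c <= 13 * k,
        beta1 Pbar c <= expR (- (n%:R * (th1 - 5 * (d / 8)))) /\
        beta2 Pbar c <= expR (- (n%:R * (th2 - 8 * (d / 8)))),
        0 < ((size1 c)%:R : R) <= expR (n%:R * (R1 + 3 * (d / 8))) &
        0 < ((size2 c)%:R : R) <= expR (n%:R * (R2 + 3 * (d / 8)))].
    by near: n; apply: near_code => //; rewrite divr_gt0.
  exists c; split.
  - by apply: (le_trans a1); rewrite kE ge_min lexx.
  - by apply: (le_trans a2); rewrite kE ge_min lexx orbT.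
  - split; [apply: le_trans (rate _ _ _ n0 _ b1)|apply: le_trans (rate _ _ _ n0 _ b2)];
      rewrite ?beta_ge0 // lee_fin; lra.
  - by apply: (le_trans (lnr _ _ _ n0 s1)); lra.
  - by apply: (le_trans (lnr _ _ _ n0 s2)); lra.
have [c cgood] := diagonal_choice dflt mono ex.
exists c; split; [|split; [|split; [|split; [|split]]]];
  (try apply: limn_esup_le_eps); (try apply: limn_einf_ge_eps) => d d0;
  have := cgood d d0; apply: filterS => n [a b [f g] h i] //=; rewrite lee_fin //.
- by apply: (le_trans a); rewrite lerDl ltW.
- by apply: (le_trans b); rewrite lerDl ltW.
Unshelve. all: by end_near. Qed.

End Assembly.

Theorem theorem1 (R : realType) (X Y1 Y2 : finType)
  (P Pbar : X -> Y1 -> Y2 -> R)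
  (HP : is_pmf (fun w : X * Y1 * Y2 => P w.1.1 w.1.2 w.2))
  (HPbar : is_pmf (fun w : X * Y1 * Y2 => Pbar w.1.1 w.1.2 w.2))
  (HPbar_pos : forall x y1 y2, 0 < Pbar x y1 y2)
  (R1 R2 eps1 eps2 : R)
  (HR1 : 0 <= R1) (HR2 : 0 <= R2)
  (He1 : 0 < eps1 < 1) (He2 : 0 < eps2 < 1)
  (th1 th2 : R) (Hth1 : 0 <= th1) (Hth2 : 0 <= th2) :
  (exists (U V : finType) (Q : U -> V -> X -> Y1 -> Y2 -> R),
      in_S Q P R1 R2
   /\ (forall t : U -> X -> Y1 -> R,
         in_L1 Q t -> (th1%:E <= div1 Q Pbar t)%E)
   /\ (forall t : U -> V -> X -> Y1 -> Y2 -> R,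
         in_L2 Q t -> (th2%:E <= div2 Q Pbar t)%E)) ->
  region P Pbar R1 R2 eps1 eps2 (th1, th2).
Proof.
move=> [U [V [Q [HQ [HL1 HL2]]]]]; apply: subset_closure => /=.
have /andP[e1 _] := He1; have /andP[e2 _] := He2.
exact: (in_S_achievable HQ HPbar_pos HP HL1 HL2 e1 e2).
Qed.
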